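(* Let $d\ge2$ and let $Z\subset\mathbb{R}^d$ be a full-dimensional zonotope with $Z=-Z$. Then the following are equivalent: (i) $Z$ is vertex-transitive. (ii) All semi-stars of $\mathrm{Gen}(Z)$ are congruent. (iii) $\mathrm{Gen}(Z)$ is a root system. (iv) $Z$ is a $\Gamma$-permutahedron for some finite reflection group $\Gamma\subset\mathrm{O}(\mathbb{R}^d)$.
   Context: A zonotope is a polytope that is a Minkowski sum of finitely many line segments. The set of generators of $Z$ is $\mathrm{Gen}(Z)=\{r\in\mathbb{R}^d\setminus\{0\}\mid \mathrm{conv}\{-r,r\}\text{ is a translate of an edge of }Z\}$, a finite centrally symmetric set. For a polytope $P\subset\mathbb{R}^d$, $\mathrm{Aut}(P)=\{T\in\mathrm{O}(\mathbb{R}^d)\mid TP=P\}$, and $P$ is vertex-transitive if $\mathrm{Aut}(P)$ acts transitively on the vertices of $P$. A semi-star of a finite centrally symmetric set $R\subset\mathbb{R}^d\setminus\{0\}$ is a subset $S\subseteq R$ that contains exactly half the elements of $R$ and is the intersection of $R$ with a half-space; equivalently, $S=\{r\in R\mid\langle r,c\rangle>0\}$ for some $c\in\mathbb{R}^d\setminus\{0\}$ that is non-orthogonal to every $r\in R$. Two semi-stars $S,S'$ are congruent if $TS=S'$ for some $T\in\mathrm{O}(\mathbb{R}^d)$. Write $T_r=\mathrm{Id}-2rr^{\top}/\|r\|^2$ for the reflection on $r^\perp$. A root system is a finite set $R\subset\mathbb{R}^d\setminus\{0\}$ with $T_rR=R$ for all $r\in R$ (no crystallographic or reducedness condition). A finite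 reflection group $\Gamma\subset\mathrm{O}(\mathbb{R}^d)$ is a finite group generated by reflections $T_r$, $r\in R$, for some finite set $R\subset\mathbb{R}^d\setminus\{0\}$. A $\Gamma$-permutahedron is a polytope $P\subset\mathbb{R}^d$ such that $\Gamma$ acts regularly (transitively and freely) on the vertices of $P$; equivalently, $P=\mathrm{conv}(\Gamma v)$ for a point $v$ not lying on any reflection hyperplane of $\Gamma$. *)

(* Defs.v *)
From HB Require Import structures.
From mathcomp Require Import all_boot all_order all_algebra finmap.
From mathcomp Require Import boolp classical_sets functions cardinality reals.
From mathcomp Require Import convex.

Set Implicit Arguments.
Unset Strict Implicit.
Unset Printing Implicit Defensive.

Import Order.TTheory GRing.Theory Num.Theory.
Local Open Scope classical_set_scope.
Local Open Scope card_scope.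
Local Open Scope ring_scope.

(* Vectors of R^d are columns.  The library norm on matrices is the maximum
   norm, so the Euclidean structure is given by dot. *)
Section Zonotopes.
Context {R : realType} {d : nat}.
Notation vec := 'cV[R]_d.
Notation mx := 'M[R]_d.
Implicit Types (P F : set vec) (S Rt : set vec) (T : mx) (G : set mx).

Definition dot (u v : vec) : R := (u^T *m v) 0 0.

Definition mximage T (A : set vec) : set vec := [set T *m x | x in A].

Definition orthogonal_group : set mx := [set T | T^T *m T = 1%:M].

Definition conv_hull (A : set vec) : set vec :=
  smallest (@convex_set R vec) A.

Definition polytope P :=
  exists A : set vec, [/\ finite_set A, A !=set0 & P = conv_hull A].

Definition minkowski_sum n (A : 'I_n -> set vec) : set vec :=
  [set \sum_i f i | f in [set f : 'I_n -> vec | forall i, A i (f i)]].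

Definition zonotope P :=
  polytope P /\
  exists (n : nat) (a b : 'I_n -> vec),
    P = minkowski_sum (fun i => conv_hull [set a i; b i]).

(* The second condition says that U is the linear span of the differences of
   points of A, that is, the direction of the affine hull of A. *)
Definition affine_dim (A : set vec) (k : nat) :=
  A !=set0 /\
  exists2 U : {vspace vec}, \dim U = k &
    forall V : {vspace vec},
      (U <= V)%VS <-> (forall x y, A x -> A y -> x - y \in V).

Definition full_dimensional P := affine_dim P d.

(* The case c = 0 makes P and the empty set faces of P. *)
Definition face P F :=
  exists (c : vec) (h : R),
    (forall x, P x -> dot x c <= h) /\ F = P `&` [set x | dot x c = h].

Definition edge P F := face P F /\ affine_dim F 1.

Definition vertices P : set vec := [set v | face P [set v]].

Definition Gen P : set vec :=
  [set r | r != 0 /\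
     exists (F : set vec) (t : vec),
       edge P F /\ conv_hull [set - r; r] = [set x + t | x in F]].

Definition acts_transitively G (V : set vec) :=
  (forall T v, G T -> V v -> V (T *m v)) /\
  (forall v w, V v -> V w -> exists2 T, G T & T *m v = w).

Definition acts_freely G (V : set vec) :=
  forall T v, G T -> V v -> T *m v = v -> T = 1%:M.

Definition acts_regularly G (V : set vec) :=
  acts_transitively G V /\ acts_freely G V.

Definition Aut P : set mx := [set T | orthogonal_group T /\ mximage T P = P].

Definition vertex_transitive P := acts_transitively (Aut P) (vertices P).

(* Affine open half-spaces.  The choice of open or closed, linear or affine
   does not affect semi_star on a finite centrally symmetric set; semi_starP
   below gives the form with a vector c non-orthogonal to all elements. *)
Definition half_space (H : set vec) :=
  exists (c : vec) (a : R), c != 0 /\ H = [set x | a < dot x c].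

Definition semi_star Rt S :=
  (exists n, S #= `I_n /\ Rt #= `I_(n.*2)) /\
  (exists2 H, half_space H & S = Rt `&` H).

Definition congruent S S' :=
  exists2 T, orthogonal_group T & mximage T S = S'.

Definition reflection (r : vec) : mx :=
  1%:M - (2 / dot r r) *: (r *m r^T).

Definition root_system Rt :=
  [/\ finite_set Rt, ~ Rt 0 & forall r, Rt r -> mximage (reflection r) Rt = Rt].

Definition orthogonal_subgroup G :=
  [/\ G `<=` orthogonal_group, G 1%:M,
      forall T T', G T -> G T' -> G (T *m T') & forall T, G T -> G (invmx T)].

Definition finite_reflection_group G :=
  finite_set G /\
  exists Rt, [/\ finite_set Rt, ~ Rt 0 &
    G = smallest orthogonal_subgroup [set reflection r | r in Rt]].

Definition permutahedron G P := polytope P /\ acts_regularly G (vertices P).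

Lemma dotNl (u v : vec) : dot (- u) v = - dot u v.
Proof. by rewrite /dot linearN /= mulNmx mxE. Qed.

Lemma oppsetP (A : set vec) x : [set - y | y in A] x <-> A (- x).
Proof.
split; first by case=> y Ay <-; rewrite opprK.
by move=> Ax; exists (- x) => //; rewrite opprK.
Qed.

Lemma card_oppset (A : set vec) : [set - y | y in A] #= A.
Proof. by apply: inj_card_eq => x y _ _; apply: oppr_inj. Qed.

Lemma half_cover n (A Rt : set vec) :
  A #= `I_n -> Rt #= `I_(n.*2) -> A `<=` Rt ->
  (forall x, Rt x -> Rt (- x)) -> (forall x, A x -> ~ A (- x)) ->
  forall x, Rt x -> A x \/ A (- x).
Proof.
move=> An Rn AR Rsym Aanti x Rx.
have finA : finite_set A by apply/finite_setP; exists n.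
have finR : finite_set Rt by apply/finite_setP; exists n.*2.
set B := [set - y | y in A].
have finB : finite_set B by apply: finite_image.
have Bn : B #= `I_n by apply: card_eq_trans An; apply: card_oppset.
have AB0 : A `&` B = set0.
  rewrite -subset0 => y [Ay /oppsetP Ay']; exact: (Aanti y).
have ABR : A `|` B `<=` Rt.
  move=> y [/AR //|/oppsetP /AR /Rsym]; by rewrite opprK.
have fABR : (fset_set (A `|` B) `<=` fset_set Rt)%fset.
  by rewrite -fset_set_sub //; rewrite finite_setU.
have E : fset_set (A `|` B) = fset_set Rt.
  apply/eqP; rewrite eqEfcard fABR /= (card_fset_set Rn).
  rewrite fset_setU // cardfsU -fset_setI // AB0 fset_set0 cardfs0 subn0.
  by rewrite (card_fset_set An) (card_fset_set Bn) addnn.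
have : (A `|` B) x.
  suff: x \in fset_set (A `|` B) by rewrite in_fset_set ?inE // finite_setU.
  by rewrite E in_fset_set ?inE.
by case=> [|/oppsetP]; [left|right].
Qed.

Lemma semi_starP Rt S : finite_set Rt -> (forall r, Rt r -> Rt (- r)) ->
  semi_star Rt S <->
  exists c : vec, [/\ c != 0, forall r, Rt r -> dot r c != 0 &
    S = [set r | Rt r /\ 0 < dot r c]].
Proof.
move=> finR Rsym; split; last first.
  case=> c [c0 Rc SE].
  have SR : S `<=` Rt by rewrite SE => x [].
  have finS : finite_set S by apply: sub_finite_set finR.
  have [n Sn] : exists n, S #= `I_n by apply/finite_setP.
  split; last by exists [set x | 0 < dot x c] => //; exists c, 0.
  exists n; split=> //; set B := [set - y | y in S].
  have finB : finite_set B by apply: finite_image.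
  have Bn : B #= `I_n by apply: card_eq_trans Sn; apply: card_oppset.
  have RE : Rt = S `|` B.
    rewrite eqEsubset; split=> x; last first.
      by move=> [/SR //|/oppsetP /SR /Rsym]; rewrite opprK.
    move=> Rx; have := Rc x Rx; rewrite neq_lt => /orP [xc|xc].
      by right; apply/oppsetP; rewrite SE /= dotNl oppr_gt0; split=> //; exact: Rsym.
    by left; rewrite SE.
  have SB0 : S `&` B = set0.
    rewrite -subset0 => y [Sy /oppsetP]; move: Sy; rewrite SE /= dotNl oppr_gt0.
    by move=> [_ /lt_trans h [_ /h]]; rewrite ltxx.
  have cR : #|` fset_set Rt| = n.*2.
    rewrite RE fset_setU // cardfsU -fset_setI // SB0 fset_set0 cardfs0 subn0.
    by rewrite (card_fset_set Sn) (card_fset_set Bn) addnn.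
  have [m Rm] : exists n, Rt #= `I_n by apply/finite_setP.
  by rewrite -cR (card_fset_set Rm).
case=> -[n [Sn Rn]] [_ [c [a [c0 ->]]] SE]; exists c.
have SR : S `<=` Rt by rewrite SE => x [].
suff Rc r : Rt r -> dot r c != 0 /\ (a < dot r c <-> 0 < dot r c).
  split=> //; first by move=> r /Rc [].
  rewrite SE eqEsubset; split=> x [Rx /= hx]; split=> //; by apply/(Rc _ Rx).2.
move=> Rr; have [a0|a0] := leP 0 a.
  have anti x : S x -> ~ S (- x).
    rewrite SE /= dotNl => -[_ ax] [_ ax'].
    have := le_lt_trans a0 ax'; rewrite oppr_gt0 => /(lt_trans (le_lt_trans a0 ax)).
    by rewrite ltxx.
  have [] := half_cover Sn Rn SR Rsym anti Rr.
    rewrite SE /= => -[_ h]; have h0 := le_lt_trans a0 h.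
    by rewrite gt_eqF // h h0.
  rewrite SE /= dotNl => -[_ h]; have := le_lt_trans a0 h.
  rewrite oppr_gt0 => h0; split; first by rewrite lt_eqF.
  by rewrite !ltNge (ltW h0) (le_trans (ltW h0) a0).
pose A := Rt `\` S.
have finS : finite_set S by apply: sub_finite_set finR.
have An : A #= `I_n.
  have finA : finite_set A by apply: finite_setD.
  have [m Am] : exists n, A #= `I_n by apply/finite_setP.
  suff <- : m = n by [].
  rewrite -(card_fset_set Am) fset_setD // cardfsD -fset_setI // setIidr //.
  by rewrite (card_fset_set Sn) (card_fset_set Rn) -addnn addnK.
have AR : A `<=` Rt by move=> x [].
have AE x : A x -> dot x c <= a.
  by case=> Rx nS; rewrite leNgt; apply/negP => h; apply: nS; rewrite SE.
have anti x : A x -> ~ A (- x).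
  move=> /AE /le_lt_trans /(_ a0) h /AE /le_lt_trans /(_ a0).
  by rewrite dotNl oppr_lt0 => /(lt_trans h); rewrite ltxx.
have [/AE h|/AE] := half_cover An Rn AR Rsym anti Rr.
  have h0 := le_lt_trans h a0; split; first by rewrite lt_eqF.
  by rewrite !ltNge h (ltW h0).
rewrite dotNl => h; have := le_lt_trans h a0; rewrite oppr_lt0 => h0.
by rewrite gt_eqF // h0 (lt_trans a0 h0).
Qed.

End Zonotopes.

(* Main.v *)
Require Import Defs.
From mathcomp Require Import all_boot all_order all_algebra.
From mathcomp Require Import boolp classical_sets cardinality reals convex unstable.
From mathcomp Require Import interval_inference ring lra zify.

Set Implicit Arguments.
Unset Strict Implicit.
Unset Printing Implicit Defensive.

Import Order.TTheory GRing.Theory Num.Theory.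
Local Open Scope classical_set_scope.
Local Open Scope ring_scope.

(** After translation and after merging parallel segments, [Z] is the set of
    sums of [t_i g_i] with [|t_i| <= 1], for a list [gs] of pairwise nonparallel
    vectors; symmetry of [Z] forces the translation to vanish.  Such a set is
    cut out by its support function, the sum of the [|<g_i, c>|] ([zonoP]).
    Faces are then explicit ([zono_faceP]): the vertices are the sums of the
    [sg <g_i, c> g_i] for [c] orthogonal to no generator, and [Gen Z] consists
    of the [g_i] and [- g_i] ([Gen_zono]).  So vertices, semi-stars of [Gen Z],
    and chambers of the arrangement of the hyperplanes [g_i^perp] are the same
    thing, and every implication is a statement about the arrangement.

    (i) => (ii): a symmetry of [Z] permutes the generators, and if it maps one
    vertex to another then it maps the corresponding semi-stars to each other.

    (ii) => (iii): two semi-stars separated by the hyperplane of [r] alone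
    differ in the sign of [r] only.  Congruent sets contain equally many pairs
    [(a, b)] with given [|a|^2 + |b|^2] and [<a, b>]; after cancelling the pairs
    that avoid [r], the rest of the semi-star is balanced: for each length it
    has as many vectors with product [z] with [r] as with product [- z]
    ([wall_balance]).  Given a second generator [s], this is used at the two
    places of the hyperplane of [r] on either side of the codimension two space
    orthogonal to [r] and [s].  There the generators outside the plane of [r]
    and [s] appear with the same signs and those inside with opposite signs, so
    the generators of the plane on one side of [r] are balanced by themselves.
    In an open half-plane bounded by [r] a vector is determined by its length
    and its product with [r], hence the mirror image of [s] is a generator
    ([all_congruent_reflection]).

    (iii) => (iv): the group generated by the reflections acts regularly on the
    chambers, which is the classical theorem on finite reflection groups.  It
    is proved from simple roots: products of simple reflections move every
    chamber to the chosen one ([chamber_transitive]), they contain every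
    reflection ([reflection_simple_words]), and by the exchange condition such a
    product preserving the chosen chamber is trivial ([chamber_free]).

    (iv) => (i): the support function is a maximum over the vertices, so a group
    permuting the vertices preserves [Z]. *)

(** * Euclidean geometry and perturbation of directions *)

Section Euclid.
Context {R : realType} {d : nat}.
Notation vec := 'cV[R]_d.
Notation mx := 'M[R]_d.
Implicit Types (u v w x y c r s : vec) (T : mx) (L gs : seq vec).

Lemma dotE u v : dot u v = \sum_i u i 0 * v i 0.
Proof. by rewrite /dot mxE; apply: eq_bigr => i _; rewrite mxE. Qed.

Lemma dotC u v : dot u v = dot v u.
Proof. by rewrite !dotE; apply: eq_bigr => i _; rewrite mulrC. Qed.

Lemma dotDl u v w : dot (u + v) w = dot u w + dot v w.
Proof. by rewrite /dot linearD /= mulmxDl mxE. Qed.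

Lemma dotZl a u v : dot (a *: u) v = a * dot u v.
Proof. by rewrite /dot linearZ /= -scalemxAl mxE. Qed.

Lemma dotDr u v w : dot w (u + v) = dot w u + dot w v.
Proof. by rewrite dotC dotDl !(dotC w). Qed.

Lemma dotZr a u v : dot v (a *: u) = a * dot v u.
Proof. by rewrite dotC dotZl dotC. Qed.

Lemma dotNr u v : dot v (- u) = - dot v u.
Proof. by rewrite dotC dotNl dotC. Qed.

Lemma dot0l u : dot 0 u = 0.
Proof. by rewrite -(scale0r 0) dotZl mul0r. Qed.

Lemma dot0r u : dot u 0 = 0.
Proof. by rewrite dotC dot0l. Qed.

Definition dot_linear :=
  (dotDl, dotDr, dotZl, dotZr, @dotNl R d, dotNr, dot0l, dot0r).

Lemma dot_suml (I : Type) (l : seq I) (F : I -> vec) c :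
  dot (\sum_(i <- l) F i) c = \sum_(i <- l) dot (F i) c.
Proof.
by elim: l => [|i l IH]; rewrite ?big_nil ?dot0l // !big_cons dotDl IH.
Qed.

Lemma dot_ge0 u : 0 <= dot u u.
Proof. by rewrite dotE sumr_ge0 // => i _; rewrite -expr2 sqr_ge0. Qed.

Lemma dot_eq0 u : (dot u u == 0) = (u == 0).
Proof.
apply/idP/eqP => [|->]; last by rewrite dot0l.
rewrite dotE psumr_eq0 => [/allP h|i _]; last by rewrite -expr2 sqr_ge0.
apply/colP => i; rewrite mxE; apply/eqP.
by have := h i (mem_index_enum _); rewrite /= -expr2 sqrf_eq0.
Qed.

Lemma dot_gt0 u : (0 < dot u u) = (u != 0).
Proof. by rewrite lt_neqAle eq_sym dot_eq0 dot_ge0 andbT. Qed.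

Lemma dot_mulmx T u v : dot (T *m u) v = dot u (T^T *m v).
Proof. by rewrite /dot trmx_mul mulmxA. Qed.

Lemma orthogonal_trmx T : orthogonal_group T -> orthogonal_group T^T.
Proof. by rewrite /orthogonal_group /= trmxK => /mulmx1C. Qed.

Lemma orthogonalK T u : orthogonal_group T -> T^T *m (T *m u) = u.
Proof. by move=> h; rewrite mulmxA h mul1mx. Qed.

Lemma orthogonalVK T u : orthogonal_group T -> T *m (T^T *m u) = u.
Proof. by move=> h; rewrite mulmxA (mulmx1C h) mul1mx. Qed.

Lemma dot_orthogonal T u v :
  orthogonal_group T -> dot (T *m u) (T *m v) = dot u v.
Proof. by move=> h; rewrite dot_mulmx orthogonalK. Qed.

Lemma orthogonal_inv T : orthogonal_group T -> invmx T = T^T.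
Proof.
move=> h; have [h1 _] := mulmx1_unit (mulmx1C h).
by rewrite -[LHS]mul1mx -h -mulmxA mulmxV // mulmx1.
Qed.

Lemma reflectionE r x :
  reflection r *m x = x - (2 * dot r x / dot r r) *: r.
Proof.
rewrite /reflection mulmxBl mul1mx -scalemxAl -mulmxA; congr (_ - _).
have -> : r^T *m x = (dot r x)%:M by apply: mx11_scalar.
by rewrite mul_mx_scalar scalerA mulrAC.
Qed.

Lemma reflection_self r : reflection r *m r = - r.
Proof.
rewrite reflectionE; have [->|r0] := eqVneq r 0; first by rewrite scaler0 subr0 oppr0.
have := r0; rewrite -dot_eq0 => r0'.
by rewrite mulfK // scaler_nat mulr2n opprD addrA subrr sub0r.
Qed.

Lemma reflection_fix r x : dot r x = 0 -> reflection r *m x = x.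
Proof. by move=> h; rewrite reflectionE h mulr0 mul0r scale0r subr0. Qed.

Lemma reflectionK r x : r != 0 -> reflection r *m (reflection r *m x) = x.
Proof.
rewrite -dot_eq0 => r0; rewrite !reflectionE !dot_linear -addrA -opprD -scalerDl.
rewrite [X in X *: _](_ : _ = 0) ?scale0r ?subr0 //; by field.
Qed.

Lemma reflection_tr r : (reflection r)^T = reflection r.
Proof. by rewrite /reflection linearB /= linearZ /= trmx_mul trmxK trmx1. Qed.

Lemma reflection_orth r : r != 0 -> orthogonal_group (reflection r).
Proof.
move=> r0; rewrite /orthogonal_group /= reflection_tr.
apply/row_matrixP => i; rewrite -[LHS]trmxK -[RHS]trmxK; congr (_^T).
rewrite !tr_row trmx_mul reflection_tr trmx1 !colE -mulmxA.
by rewrite reflectionK // mul1mx.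
Qed.

Lemma dot_reflection r u v :
  dot (reflection r *m u) v = dot u (reflection r *m v).
Proof. by rewrite dot_mulmx reflection_tr. Qed.

Lemma reflection_conj T r : orthogonal_group T ->
  reflection (T *m r) = T *m reflection r *m T^T.
Proof.
move=> oT; rewrite /reflection dot_orthogonal // mulmxBr mulmxBl mulmx1.
by rewrite (mulmx1C oT) -scalemxAr -scalemxAl trmx_mul !mulmxA.
Qed.

Lemma sgrD_small (a b : R) : `|b| < `|a| -> Num.sg (a + b) = Num.sg a.
Proof.
case: (ltgtP a 0) => [a0|a0|->]; last by rewrite normr0 normr_lt0.
- rewrite (ltr0_norm a0) ltr_norml => /andP[_ h].
  by rewrite !ltr0_sg //; lra.
- rewrite (gtr0_norm a0) ltr_norml => /andP[h _].
  by rewrite !gtr0_sg //; lra.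
Qed.

Lemma small_step L c u :
  exists2 e : R, 0 < e & forall e', 0 < e' <= e -> forall x, x \in L ->
    dot x c != 0 -> Num.sg (dot x (c + e' *: u)) = Num.sg (dot x c).
Proof.
elim: L => [|y L [e e0 IH]]; first by exists 1.
pose ey := if dot y c == 0 then 1 else `|dot y c| / (1 + `|dot y u|).
have n0 : 0 < 1 + `|dot y u| by rewrite ltr_pwDl.
have ey0 : 0 < ey.
  by rewrite /ey; case: eqVneq => // h; rewrite divr_gt0 // normr_gt0.
exists (Num.min e ey); first by rewrite lt_min e0.
move=> e' /andP[e'0]; rewrite le_min => /andP[e'e e'y] x.
rewrite inE => /orP[/eqP-> yc|xL]; last by apply: IH => //; rewrite e'0.
rewrite dotDr dotZr sgrD_small // normrM gtr0_norm //.
move: e'y; rewrite /ey (negPf yc) ler_pdivlMr // => h.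
by apply: lt_le_trans h; rewrite ltr_pM2l // ltrDr.
Qed.

(** Lexicographic perturbation: a direction [c] on some of the hyperplanes [x^perp]
    is moved off them to the side chosen by [u], by a step too small to cross
    any other hyperplane. *)
Lemma lex_direction L c u : exists2 e : R, 0 < e & forall x, x \in L ->
  Num.sg (dot x (c + e *: u)) =
    if dot x c == 0 then Num.sg (dot x u) else Num.sg (dot x c).
Proof.
have [e e0 h] := small_step L c u; exists e => // x xL.
case: eqVneq => [xc|xc]; last by apply: h => //; rewrite e0 lexx.
by rewrite dotDr dotZr xc add0r sgrM gtr0_sg // mul1r.
Qed.

(** The hyperplanes [x^perp] are left one at a time by small steps inside [W],
    starting from [c0].  No step recrosses a hyperplane, which is why the signs
    already decided by [c0] persist. *)
Lemma generic_direction (W : set vec) L c0 :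
  (forall u v (e : R), W u -> W v -> W (u + e *: v)) -> W c0 ->
  (forall x, x \in L -> exists2 u, W u & dot x u != 0) ->
  exists2 c, W c & forall x, x \in L -> dot x c != 0 /\
    (dot x c0 != 0 -> Num.sg (dot x c) = Num.sg (dot x c0)).
Proof.
move=> Wadd Wc0 WL.
suff h (K : seq vec) : {subset K <= L} -> exists c, [/\ W c,
    forall x, x \in K -> dot x c != 0 &
    forall x, x \in L -> dot x c0 != 0 -> Num.sg (dot x c) = Num.sg (dot x c0)].
  have [//|c [Wc h1 h2]] := h L; exists c => // x xL; split; [exact: h1|exact: h2].
elim: K => [|x K IH] KL; first by exists c0.
have [|c [Wc h1 h2]] := IH; first by move=> y yK; rewrite KL // inE yK orbT.
have xL : x \in L by rewrite KL // inE eqxx.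
have [u Wu xu] := WL x xL; have [e e0 he] := lex_direction L c u.
exists (c + e *: u); split; first exact: Wadd.
- move=> y; rewrite inE -sgr_eq0 => /orP[/eqP->|yK].
    by rewrite he //; case: ifPn => h; rewrite sgr_eq0.
  by rewrite he ?KL ?inE ?yK ?orbT // (negPf (h1 _ yK)) sgr_eq0 h1.
- move=> y yL yc; have yc' : dot y c != 0 by rewrite -sgr_eq0 h2 // sgr_eq0.
  by rewrite he // (negPf yc') h2.
Qed.

End Euclid.

(** * Zonotopes given by a list of generators *)

Section Zonotope.
Context {R : realType} {d : nat}.
Notation vec := 'cV[R]_d.
Notation mx := 'M[R]_d.
Implicit Types (u v w x y c r s g : vec) (T : mx) (L gs : seq vec).

Fixpoint zono gs : set vec :=
  if gs is g :: gs' then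
    [set x | exists2 t : R, `|t| <= 1 & zono gs' (x - t *: g)]
  else [set 0].

(** The support function of [zono gs]. *)
Definition supp gs c : R := \sum_(g <- gs) `|dot g c|.

(** The point where [zono gs] attains its maximum in the direction [c], when
    no generator is orthogonal to [c]. *)
Definition vert gs c : vec := \sum_(g <- gs) Num.sg (dot g c) *: g.

Lemma supp_cons g gs c : supp (g :: gs) c = `|dot g c| + supp gs c.
Proof. by rewrite /supp big_cons. Qed.

Lemma supp_ge0 gs c : 0 <= supp gs c.
Proof. exact: sumr_ge0. Qed.

Lemma suppZ gs a c : supp gs (a *: c) = `|a| * supp gs c.
Proof.
by rewrite /supp mulr_sumr; apply: eq_bigr => g _; rewrite dotZr normrM.
Qed.

Lemma supp_add gs c c' : supp gs (c + c') <= supp gs c + supp gs c'.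
Proof.
rewrite /supp -big_split /=; apply: ler_sum => g _.
by rewrite dotDr ler_normD.
Qed.

Lemma dot_vert gs c : dot (vert gs c) c = supp gs c.
Proof.
rewrite /vert dot_suml; apply: eq_bigr => g _.
by rewrite dotZl -normrEsg.
Qed.

(** The separation theorem for zonotopes, by an induction in the manner of
    Hahn and Banach.  When the generator [g] is added, every direction [c]
    bounds the admissible coefficient [t] of [g] on one side; the bounds are
    compatible because the support function is sublinear, and [t] is taken as
    the supremum of the lower bounds, normalized to [<g, c> = 1]. *)
Lemma zonoP gs x : zono gs x <-> forall c, dot x c <= supp gs c.
Proof.
elim: gs x => [|g gs IH] x /=.
  split=> [-> c|h]; first by rewrite dot0l supp_ge0.
  apply/eqP; rewrite -dot_eq0 eq_le dot_ge0 andbT.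
  by have := h x; rewrite /supp big_nil.
split.
  move=> [t t1 /IH h] c; rewrite supp_cons.
  have := h c; rewrite !dot_linear lerBlDl => /le_trans; apply.
  rewrite lerD2r; apply: le_trans (ler_norm _) _.
  by rewrite normrM ler_piMl.
move=> h.
pose E : set R := [set t | t = -1 \/
  exists2 c, dot g c = 1 & t = dot x c - supp gs c].
have Eub b : -1 <= b ->
    (forall c, dot g c = 1 -> dot x c - supp gs c <= b) -> sup E <= b.
  move=> b1 bc; apply: ge_sup; first by exists (-1); left.
  by move=> t [->//|[c gc ->]]; exact: bc.
have E1 : sup E <= 1.
  apply: Eub => [|c gc]; first by lra.
  by have := h c; rewrite supp_cons gc normr1; lra.
have supE : has_sup E.
  split; first by exists (-1); left.
  exists 1 => t [->|[c gc ->]]; first by lra.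
  by have := h c; rewrite supp_cons gc normr1; lra.
exists (sup E).
  rewrite ler_norml E1 andbT; apply: sup_upper_bound => //; by left.
apply/IH => c; rewrite !dot_linear.
have [gc|gc|gc] := ltgtP (dot g c) 0.
- have inv : 0 < (- dot g c)^-1 by rewrite invr_gt0 oppr_gt0.
  suff : sup E <= supp gs ((- dot g c)^-1 *: c) - dot x ((- dot g c)^-1 *: c).
    rewrite suppZ dotZr gtr0_norm // -mulrBr mulrC ler_pdivlMr ?oppr_gt0 //.
    lra.
  set c2 := _ *: c.
  have gc2 : dot g c2 = -1 by rewrite dotZr invrN mulNr mulVf // lt_eqF.
  apply: Eub.
    by have := h c2; rewrite supp_cons gc2 normrN1; lra.
  move=> c1 gc1; have := h (c1 + c2); have := supp_add gs c1 c2.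
  rewrite supp_cons !dotDr gc1 gc2 subrr normr0; lra.
- suff : dot x ((dot g c)^-1 *: c) - supp gs ((dot g c)^-1 *: c) <= sup E.
    rewrite suppZ dotZr gtr0_norm ?invr_gt0 // -mulrBr mulrC ler_pdivrMr //.
    lra.
  apply: sup_upper_bound => //; right; eexists; last by [].
  by rewrite dotZr mulVf // gt_eqF.
- by have := h c; rewrite supp_cons gc normr0 mulr0; lra.
Qed.

Lemma zono0 gs : zono gs 0.
Proof. by apply/zonoP => c; rewrite dot0l supp_ge0. Qed.

Lemma zono_gen gs g : g \in gs -> zono gs g.
Proof.
move=> ggs; apply/zonoP => c; apply: le_trans (ler_norm _) _.
by rewrite /supp (perm_big _ (perm_to_rem ggs)) big_cons lerDl supp_ge0.
Qed.

Lemma zonoN gs x : zono gs x -> zono gs (- x).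
Proof.
move/zonoP => h; apply/zonoP => c; rewrite dotNl -dotNr.
by have := h (- c); rewrite -(scaleN1r c) suppZ normrN1 mul1r.
Qed.

(** A maximizer of [<., c>] must maximize each term [t_i <g_i, c>] separately,
    which forces [t_i = sg <g_i, c>] and leaves free only the coefficients of the
    generators orthogonal to [c]. *)
Lemma zono_faceP gs c x :
  zono gs x /\ dot x c = supp gs c <->
  zono [seq g <- gs | dot g c == 0] (x - vert gs c).
Proof.
elim: gs x => [|g gs IH] x /=.
  rewrite /vert /supp !big_nil subr0; split=> [[]//|->].
  by rewrite dot0l.
rewrite /vert supp_cons big_cons -/(vert gs c).
have lesupp y : zono gs y -> dot y c <= supp gs c by move/zonoP; apply.
case: eqVneq => gc /=.
  rewrite gc normr0 add0r sgr0 scale0r add0r; split.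
    move=> [[t t1 ht] hx]; exists t => //; rewrite addrAC; apply/IH; split=> //.
    by rewrite !dot_linear gc mulr0 subr0.
  move=> [t t1]; rewrite addrAC => /IH[h1 h2]; split; first by exists t.
  by move: h2; rewrite !dot_linear gc mulr0 subr0.
rewrite opprD addrA; split.
  move=> [[t t1 ht] hx]; apply/IH.
  have gc0 : 0 < `|dot g c| by rewrite normr_gt0.
  suff <- : t = Num.sg (dot g c).
    split=> //; apply/eqP; rewrite eq_le lesupp // !dot_linear hx.
    have : t * dot g c <= `|dot g c|.
      by apply: le_trans (ler_norm _) _; rewrite normrM ler_piMl.
    by lra.
  have hle := lesupp _ ht; rewrite !dot_linear hx in hle.
  have le1 : `|dot g c| <= t * dot g c by lra.
  have eq1 : t * dot g c = `|dot g c|.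
    apply/eqP; rewrite eq_le le1 andbT; apply: le_trans (ler_norm _) _.
    by rewrite normrM ler_piMl.
  by apply: (mulIf gc); rewrite eq1 normrEsg.
move=> /IH [h1 h2]; split.
  by exists (Num.sg (dot g c)) => //; rewrite normr_sg gc.
by move: h2; rewrite !dot_linear -normrEsg; lra.
Qed.

Lemma zono_vert gs c : zono gs (vert gs c).
Proof. by have [] := (zono_faceP gs c (vert gs c)).2 ltac:(by rewrite subrr; exact: zono0). Qed.

Definition generic gs c := forall g, g \in gs -> dot g c != 0.

Lemma vert_unique gs c x : generic gs c ->
  zono gs x -> dot x c = supp gs c -> x = vert gs c.
Proof.
move=> gen zx xc; have /zono_faceP := conj zx xc.
have -> : [seq g <- gs | dot g c == 0] = [::].
  by apply/eqP; rewrite -[_ == _]negbK -has_filter -all_predC; apply/allP.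
by move=> /= /eqP; rewrite subr_eq0 => /eqP.
Qed.

(** Equality in the sum of the inequalities [sg <g,c'> <g,c> <= |<g,c>|] forces
    equality in each of them: a vertex remembers the chamber of the directions
    in which it is maximal. *)
Lemma vert_sign gs c c' : generic gs c -> generic gs c' ->
  vert gs c = vert gs c' ->
  forall g, g \in gs -> Num.sg (dot g c) = Num.sg (dot g c').
Proof.
move=> gen gen' e g ggs.
have term h : 0 <= `|dot h c| - Num.sg (dot h c') * dot h c.
  rewrite subr_ge0; apply: le_trans (ler_norm _) _; rewrite normrM ler_piMl //.
  by rewrite normr_sg; case: (_ != 0).
have : \sum_(h <- gs) (`|dot h c| - Num.sg (dot h c') * dot h c) == 0.
  rewrite sumrB subr_eq0 -/(supp gs c) -dot_vert e /vert dot_suml.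
  by apply/eqP; apply: eq_bigr => h _; rewrite dotZl.
rewrite psumr_eq0 // => /allP /(_ g ggs) /=; rewrite normrEsg -mulrBl.
by rewrite mulf_eq0 (negPf (gen g ggs)) orbF subr_eq0 => /eqP.
Qed.

Lemma eq_vert gs c c' :
  (forall g, g \in gs -> Num.sg (dot g c) = Num.sg (dot g c')) ->
  vert gs c = vert gs c'.
Proof. by move=> h; apply: eq_big_seq => g /h ->. Qed.

Lemma eq_zono_supp gs gs' : zono gs = zono gs' -> supp gs =1 supp gs'.
Proof.
move=> e c; apply/eqP; rewrite eq_le; apply/andP; split.
  by rewrite -dot_vert; have := zono_vert gs c; rewrite e => /zonoP.
by rewrite -dot_vert; have := zono_vert gs' c; rewrite -e => /zonoP.
Qed.

Lemma eq_supp_zono gs gs' : supp gs =1 supp gs' -> zono gs = zono gs'.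
Proof. by move=> e; apply/seteqP; split=> x /zonoP h; apply/zonoP => c; have := h c; rewrite e. Qed.

Lemma supp_map gs T c : supp (map (mulmx T) gs) c = supp gs (T^T *m c).
Proof. by rewrite /supp big_map; apply: eq_bigr => g _; rewrite dot_mulmx. Qed.

Lemma zono_map gs T : orthogonal_group T ->
  mximage T (zono gs) = zono (map (mulmx T) gs).
Proof.
move=> oT; apply/seteqP; split=> x.
  move=> [y /zonoP h <-]; apply/zonoP => c.
  by rewrite supp_map dot_mulmx.
move=> /zonoP h; exists (T^T *m x); last exact: orthogonalVK.
apply/zonoP => c; rewrite dot_mulmx trmxK.
by have := h (T *m c); rewrite supp_map orthogonalK.
Qed.

Lemma face_singleton (P : set vec) v c h :
  (forall x, P x -> dot x c <= h) -> [set v] = P `&` [set x | dot x c = h] ->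
  [/\ P v, dot v c = h & forall x, P x -> dot x c = h -> x = v].
Proof.
move=> _ e; have [Pv vh] : (P `&` [set x | dot x c = h]) v by rewrite -e.
split=> // x Px xh; suff : [set v] x by [].
by rewrite e.
Qed.

(** A generator orthogonal to [c] lies in the centred face in the direction [c],
    which is then not a single point. *)
Lemma vertices_zono gs v : 0 \notin gs ->
  vertices (zono gs) v <-> exists2 c, generic gs c & v = vert gs c.
Proof.
move=> n0; split.
  move=> [c [h [ub /(face_singleton ub)[zv vh uniq]]]].
  have hE : supp gs c = h.
    apply/eqP; rewrite eq_le -{2}vh (zonoP _ _).1 // andbT -dot_vert.
    exact/ub/zono_vert.
  exists c; last by symmetry; apply: uniq; [exact: zono_vert|rewrite dot_vert].
  have all0 y : zono [seq g <- gs | dot g c == 0] y -> y + vert gs c = v.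
    move=> zy; have [|h1 h2] := (zono_faceP gs c (y + vert gs c)).2.
      by rewrite addrK.
    by apply: uniq => //; rewrite h2 hE.
  move=> g ggs; apply/eqP => gc; move: n0; suff -> : 0 = g by rewrite ggs.
  apply: (addIr (vert gs c)); rewrite !all0 //; last exact: zono0.
  by apply: zono_gen; rewrite mem_filter gc eqxx.
move=> [c gen ->]; exists c, (supp gs c); split; first by move=> x /zonoP.
apply/seteqP; split=> x /=.
  by move=> ->; split; [exact: zono_vert|exact: dot_vert].
by move=> [zx xc]; exact: vert_unique.
Qed.

(** [T *m vert gs c] is the only maximizer in the direction [T *m c], so by the
    same argument no generator is orthogonal to [T *m c]. *)
Lemma generic_orthogonal gs T c : orthogonal_group T ->
  mximage T (zono gs) = zono gs -> 0 \notin gs -> generic gs c ->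
  generic gs (T *m c) /\ T *m vert gs c = vert gs (T *m c).
Proof.
move=> oT TZ n0 gen.
have Tface x : zono gs x -> dot x (T *m c) = supp gs (T *m c) ->
    x = T *m vert gs c.
  rewrite -[in zono gs x]TZ => -[y zy <-]; rewrite dot_orthogonal // => yc.
  congr (_ *m _); apply: vert_unique => //; rewrite yc.
  have := eq_zono_supp (etrans (esym (zono_map gs oT)) TZ) (T *m c).
  by rewrite supp_map orthogonalK.
have vE : T *m vert gs c = vert gs (T *m c).
  by symmetry; apply: Tface; [exact: zono_vert|exact: dot_vert].
split=> // g ggs; apply/eqP => gc; move: n0; suff -> : 0 = g by rewrite ggs.
apply: (addIr (vert gs (T *m c))).
have faceg y : zono [seq g <- gs | dot g (T *m c) == 0] y ->
    y + vert gs (T *m c) = T *m vert gs c.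
  move=> zy; have [|h1 h2] := (zono_faceP gs (T *m c) (y + vert gs (T *m c))).2.
    by rewrite addrK.
  exact: Tface.
rewrite !faceg //; last exact: zono0.
by apply: zono_gen; rewrite mem_filter gc eqxx.
Qed.

End Zonotope.

(** * Reduced generators and the edges of a zonotope *)

Section Generators.
Context {R : realType} {d : nat}.
Notation vec := 'cV[R]_d.
Notation mx := 'M[R]_d.
Implicit Types (u v w x y c r s g h : vec) (T : mx) (L gs : seq vec).

Lemma conv_hull2 a b x : conv_hull [set a; b] x <->
  exists2 t : R, `|t| <= 1 & x = 2^-1 *: (a + b) + t *: (2^-1 *: (b - a)).
Proof.
split.
  apply: (@smallest_sub _ _ _ [set x | exists2 t : R, `|t| <= 1 &
      x = 2^-1 *: (a + b) + t *: (2^-1 *: (b - a))]).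
    move=> y z l; rewrite !inE => -[s s1 ->] [t t1 ->].
    exists (l%:num * s + (1 - l%:num) * t).
      have l0 : 0 <= l%:num by [].
      have l1 : l%:num <= 1 by [].
      move: s1 t1; rewrite !ler_norml => /andP[s1 s2] /andP[t1 t2].
      by apply/andP; split; nra.
    by apply/colP => i; rewrite !mxE /= /onem; ring.
  move=> y [->|->]; [exists (-1)|exists 1]; rewrite ?normrN1 ?normr1 //;
    by apply/colP => i; rewrite !mxE; field.
move=> [t]; rewrite ler_norml => /andP[t1 t2] -> A [cA sA].
have l0 : 0 <= (1 - t) / 2 by lra.
have l1 : (1 - t) / 2 <= 1 by lra.
have := cA a b (Itv01 l0 l1); rewrite !inE.
move=> /(_ (sA _ (or_introl erefl)) (sA _ (or_intror erefl))).
by congr A; apply/colP => i; rewrite !mxE /= /onem; field.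
Qed.

Lemma conv_hull_opp r x :
  conv_hull [set - r; r] x <-> exists2 t : R, `|t| <= 1 & x = t *: r.
Proof.
rewrite conv_hull2 addNr scaler0 opprK -mulr2n -[r *+ 2]scaler_nat scalerA.
rewrite mulVf ?pnatr_eq0 // scale1r.
by split=> -[t t1 ->]; exists t; rewrite ?add0r.
Qed.

Lemma zono_map_fun (I : eqType) (l : seq I) (g : I -> vec) x : uniq l ->
  zono (map g l) x <->
  exists2 t : I -> R, (forall i, `|t i| <= 1) & x = \sum_(i <- l) t i *: g i.
Proof.
elim: l x => [|i l IH] x /=.
  move=> _; split=> [->|[t _ ->]]; last by rewrite big_nil.
  by exists (fun=> 0); rewrite ?big_nil // => i; rewrite normr0.
move=> /andP[il ul]; split.
  move=> [a a1 /(IH _ ul)[t t1 e]].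
  exists (fun j => if j == i then a else t j); first by move=> j; case: ifP.
  rewrite big_cons eqxx; have -> : \sum_(j <- l) (if j == i then a else t j) *: g j
      = \sum_(j <- l) t j *: g j.
    apply: eq_big_seq => j jl; case: eqP => // ji.
    by rewrite -ji jl in il.
  by rewrite -e addrC subrK.
move=> [t t1 ->]; exists (t i) => //; apply/(IH _ ul); exists t => //.
by rewrite big_cons addrC addKr.
Qed.

(** A sum of segments is a translate [m + zono gs].  Symmetry makes [zono gs]
    invariant under the translation by [2 m], so a maximizer [x] of [<., m>] on
    it satisfies [<x + 2 m, m> <= <x, m>], whence [m = 0]. *)
Lemma symmetric_zonotope (Z : set vec) :
  zonotope Z -> Z = [set - x | x in Z] -> exists gs, Z = zono gs.
Proof.
move=> [_ [n [a [b ZE]]]] Zsym.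
pose g i : vec := 2^-1 *: (b i - a i).
pose m : vec := \sum_i 2^-1 *: (a i + b i).
pose gs := map g (index_enum 'I_n).
have Zm x : Z x <-> zono gs (x - m).
  rewrite zono_map_fun ?index_enum_uniq // ZE; split.
    move=> [f fE <-].
    have /choice[t tE] : forall i, exists t : R, `|t| <= 1 /\
        f i = 2^-1 *: (a i + b i) + t *: g i.
      by move=> i; have /conv_hull2[t t1 e] := fE i; exists t.
    exists t; first by move=> i; have [] := tE i.
    by rewrite /m -sumrB; apply: eq_bigr => i _; rewrite (tE i).2 addrC addKr.
  move=> [t t1 /eqP]; rewrite subr_eq -big_split /= => /eqP ->.
  exists (fun i => t i *: g i + 2^-1 *: (a i + b i)) => // i.
  by apply/conv_hull2; exists (t i) => //; rewrite addrC.
exists gs; suff m0 : m = 0 by apply/seteqP; split=> x; rewrite Zm m0 subr0.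
have : Z (m + vert gs m) by rewrite Zm addrC addKr; exact: zono_vert.
rewrite Zsym => /oppsetP /Zm /zonoN /zonoP /(_ m).
rewrite !dot_linear dot_vert => h; apply/eqP.
by rewrite -dot_eq0 eq_le dot_ge0 andbT; lra.
Qed.

Definition reduced gs := [/\ uniq gs, 0 \notin gs &
  forall g h (k : R), g \in gs -> h \in gs -> h = k *: g -> h = g].

(** Parallel generators may be merged: [k g] and [g] together contribute the
    same as [(1 + |k|) g]. *)
Lemma exists_reduced gs : exists2 gs', reduced gs' & supp gs =1 supp gs'.
Proof.
elim: gs => [|g gs [gs' red e]]; first by exists [::].
have e' c : supp (g :: gs) c = `|dot g c| + supp gs' c by rewrite supp_cons e.
have [g0|g0] := eqVneq g 0.
  by exists gs' => // c; rewrite e' g0 dot0l normr0 add0r.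
have [u n0 np] := red.
have [[h [k [hgs gE]]]|nopar] := pselect (exists h (k : R), h \in gs' /\ g = k *: h).
  have K0 : 0 < 1 + `|k| by rewrite ltr_pwDl.
  set K := 1 + `|k| in K0.
  have h0 : h != 0 by apply: contraNneq n0 => <-.
  have hnp h1 a : h1 \in rem h gs' -> h1 <> a *: h.
    rewrite mem_rem_uniq // inE => /andP[/eqP ne h1gs].
    by move=> /(np _ _ _ hgs h1gs).
  exists (K *: h :: rem h gs'); last first.
    move=> c; rewrite e' supp_cons /supp (perm_big _ (perm_to_rem hgs)) big_cons.
    by rewrite addrA gE !dotZl !normrM (gtr0_norm K0) /K mulrDl mul1r [_ * _ + _]addrC.
  split.
  - rewrite /= rem_uniq // andbT; apply/negP => /hnp; exact.
  - rewrite inE negb_or eq_sym scaler_eq0 (negPf h0) orbF gt_eqF //=.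
    by apply: contra n0; apply: mem_rem.
  - move=> g1 g2 a; rewrite !inE => /orP[/eqP->|g1g] /orP[/eqP->|g2g] //.
    + by rewrite scalerA => /hnp; case.
    + move=> hE; have a0 : a != 0.
        apply/eqP => a0; move/eqP: hE.
        by rewrite a0 scale0r scaler_eq0 (negPf h0) gt_eqF.
      case: (hnp g1 (a^-1 * K)) => //.
      by rewrite -scalerA hE scalerA mulVf // scale1r.
    + by apply: np; [exact: mem_rem g1g|exact: mem_rem g2g].
exists (g :: gs'); last by move=> c; rewrite e' supp_cons.
split.
- rewrite /= u andbT; apply/negP => ggs; apply: nopar; exists g, 1.
  by rewrite scale1r.
- by rewrite inE negb_or eq_sym g0.
- move=> g1 g2 a; rewrite !inE => /orP[/eqP->|g1g] /orP[/eqP->|g2g] //.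
  + move=> gE; case: nopar; exists g2, a^-1; split=> //.
    have a0 : a != 0.
      by apply: contraNneq n0 => a0; rewrite a0 scale0r in gE; rewrite -gE.
    by rewrite gE scalerA mulVf // scale1r.
  + by move=> gE; case: nopar; exists g1, a.
  + exact: np.
Qed.

(** The generators are represented by one element of each pair of opposites. *)
Definition pm gs : set vec := [set r | (r \in gs) || (- r \in gs)].

Lemma pmN gs r : pm gs r -> pm gs (- r).
Proof. by rewrite /pm /= opprK orbC. Qed.

Lemma pm_gen gs g : g \in gs -> pm gs g.
Proof. by rewrite /pm /= => ->. Qed.

Lemma pm_neq0 gs r : 0 \notin gs -> pm gs r -> r != 0.
Proof.
move=> n0; rewrite /pm /= => h; apply: contraNneq n0 => r0.
by move: h; rewrite r0 oppr0 orbb.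
Qed.

Lemma finite_pm gs : finite_set (pm gs).
Proof.
apply: (@sub_finite_set _ _ [set` gs ++ map -%R gs]); last exact: finite_seq.
move=> r /= /orP[h|h]; rewrite mem_cat ?h //.
by rewrite -[r]opprK map_f // orbT.
Qed.

Lemma pm_parallel gs r s (k : R) : reduced gs -> pm gs r -> pm gs s ->
  s = k *: r -> s = r \/ s = - r.
Proof.
move=> [_ _ np] /orP[rg|rg] /orP[sg|sg] e.
- by left; apply: np e.
- by right; rewrite -[s]opprK; congr (- _); apply: (np _ _ (- k)) => //; rewrite e scaleNr.
- by right; apply: (np _ _ (- k)) => //; rewrite e scaleNr scalerN opprK.
- by left; apply: oppr_inj; apply: (np _ _ k) => //; rewrite e scalerN.
Qed.

Lemma dot_pm_generic gs c r : generic gs c -> pm gs r -> dot r c != 0.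
Proof.
by move=> gen /orP[/gen //|/gen]; rewrite dotNl oppr_eq0.
Qed.

Definition perp r x := x - (dot x r / dot r r) *: r.

Lemma perpE r x : x = perp r x + (dot x r / dot r r) *: r.
Proof. by rewrite subrK. Qed.

Lemma dot_perp r x : r != 0 -> dot (perp r x) r = 0.
Proof.
by rewrite -dot_eq0 => r0; rewrite /perp !dot_linear divfK // subrr.
Qed.

Lemma perp_dot r x y : dot y r = 0 -> dot y (perp r x) = dot y x.
Proof. by move=> h; rewrite /perp !dot_linear h mulr0 subr0. Qed.

Lemma perpZ r a x : perp r (a *: x) = a *: perp r x.
Proof. by rewrite /perp dotZl scalerBr scalerA mulrA. Qed.

(** Any generator [g] not parallel to [r] can be avoided inside [r^perp], since
    [perp r g] is a direction of [r^perp] not orthogonal to [g]. *)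
Lemma wall_direction gs r : reduced gs -> pm gs r ->
  exists2 c, dot r c = 0 &
    forall g, pm gs g -> dot g c = 0 -> g = r \/ g = - r.
Proof.
move=> red pr; have r0 := pm_neq0 (let: And3 _ n _ := red in n) pr.
pose L := [seq g <- gs | perp r g != 0].
have [||x|c rc cL] := @generic_direction R d [set c | dot r c = 0] L 0.
- by move=> u v e /= ru rv; rewrite !dot_linear ru rv mulr0 addr0.
- exact: dot0r.
- rewrite mem_filter => /andP[x0 _]; exists (perp r x).
    by rewrite /= dotC dot_perp.
  rewrite {1}(perpE r x) dotDl dotZl (dotC r) dot_perp // mulr0 addr0.
  by rewrite dot_eq0.
exists c => // g pg gc.
have : perp r g = 0.
  apply/eqP; apply/negPn/negP => h; case/orP: pg => gg.
    by have [] := cL g; rewrite ?mem_filter ?h // gc eqxx.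
  have [] := cL (- g); last by rewrite dotNl gc oppr0 eqxx.
  rewrite mem_filter gg andbT /perp dotNl mulNr scaleNr -opprD oppr_eq0; exact: h.
by move/eqP; rewrite subr_eq0 => /eqP; apply: pm_parallel red pr pg.
Qed.

(** Each of [r] and [g] is half a difference of two points of the common
    segment, hence a multiple of the other by a factor of absolute value at
    most 1. *)
Lemma segment_length r g b : r != 0 ->
  [set x | exists2 t : R, `|t| <= 1 & x = t *: r] =
  [set x | exists2 t : R, `|t| <= 1 & x = b + t *: g] -> r = g \/ r = - g.
Proof.
move=> r0 E.
have in1 : [set x | exists2 t : R, `|t| <= 1 & x = b + t *: g] (1 *: r).
  by rewrite -E; exists 1; rewrite ?normr1.
have in2 : [set x | exists2 t : R, `|t| <= 1 & x = b + t *: g] ((-1) *: r).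
  by rewrite -E; exists (-1); rewrite ?normrN1.
have in3 : [set x | exists2 t : R, `|t| <= 1 & x = t *: r] (b + 1 *: g).
  by rewrite E; exists 1; rewrite ?normr1.
have in4 : [set x | exists2 t : R, `|t| <= 1 & x = t *: r] (b + (-1) *: g).
  by rewrite E; exists (-1); rewrite ?normrN1.
case: in1 in2 in3 in4 => [t1 T1 e1] [t2 T2 e2] [t3 T3 e3] [t4 T4 e4].
have half (p q : vec) (k l : R) : p + p = (k - l) *: q -> p = ((k - l) / 2) *: q.
  move=> h; rewrite mulrC -scalerA -h.
  by apply/colP => i; rewrite !mxE; field.
have rE : r = ((t1 - t2) / 2) *: g.
  apply: half; rewrite scalerBl.
  have -> : t1 *: g - t2 *: g = (b + t1 *: g) - (b + t2 *: g).
    by rewrite opprD addrACA subrr add0r.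
  by rewrite -e1 -e2 scale1r scaleN1r opprK.
have gE : g = ((t3 - t4) / 2) *: r.
  apply: half; rewrite scalerBl -e3 -e4 opprD addrACA subrr add0r.
  by rewrite scale1r scaleN1r opprK.
set k := (t1 - t2) / 2 in rE; set l := (t3 - t4) / 2 in gE.
have kl : k * l = 1.
  apply/eqP; rewrite -subr_eq0 -[_ == 0]orbF -(negPf r0) -scaler_eq0 scalerBl.
  by rewrite -scalerA -gE -rE scale1r subrr.
move: T1 T2 T3 T4; rewrite !ler_norml => /andP[? ?] /andP[? ?] /andP[? ?] /andP[? ?].
have k1 : -1 <= k <= 1 by apply/andP; rewrite /k; split; lra.
have l1 : -1 <= l <= 1 by apply/andP; rewrite /l; split; lra.
case/andP: k1 => k1 k2; case/andP: l1 => l1 l2.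
have ll : 0 <= 1 - l * l by nra.
have k3 : k * k * (1 - l * l) = k * k - 1.
  have -> : k * k * (1 - l * l) = k * k - (k * l) * (k * l) by ring.
  by rewrite kl mulr1.
have : (k - 1) * (k + 1) = 0.
  have k4 : 0 <= k * k * (1 - l * l) by rewrite mulr_ge0 // -expr2 sqr_ge0.
  by apply/eqP; rewrite eq_le; apply/andP; split; nra.
move/eqP; rewrite mulf_eq0 subr_eq0 addr_eq0 => /orP[]/eqP kE.
  by left; rewrite rE kE scale1r.
by right; rewrite rE kE scaleN1r.
Qed.

Lemma filter_wall gs c r : reduced gs -> pm gs r -> dot r c = 0 ->
  (forall g, pm gs g -> dot g c = 0 -> g = r \/ g = - r) ->
  exists2 g, g = r \/ g = - r & [seq g <- gs | dot g c == 0] = [:: g].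
Proof.
move=> [u n0 np] pr rc only.
have [g [ggs gr gc]] : exists g, [/\ g \in gs, g = r \/ g = - r & dot g c = 0].
  case/orP: (pr) => h; first by exists r; split=> //; left.
  by exists (- r); split=> //; [right|rewrite dotNl rc oppr0].
exists g => //; apply: perm_small_eq => //.
apply: uniq_perm => //; first exact: filter_uniq.
move=> h; rewrite mem_filter inE; apply/andP/eqP => [[/eqP hc hgs]|->]; last first.
  by rewrite gc eqxx.
have [k hE] : exists k : R, h = k *: g.
  case: (only h (pm_gen hgs) hc) gr => -> [] ->;
  by [exists 1; rewrite scale1r|exists (-1); rewrite scaleN1r ?opprK].
exact: np hE.
Qed.

Lemma zono1E g x : zono [:: g] x <-> exists2 t : R, `|t| <= 1 & x = t *: g.
Proof.
split=> -[t t1 /= h]; exists t => //; last by rewrite /= h subrr.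
by apply/eqP; rewrite -subr_eq0; apply/eqP.
Qed.

Lemma dim_line g (A : set vec) b : g != 0 ->
  A = [set x | exists2 t : R, `|t| <= 1 & x = b + t *: g] -> affine_dim A 1.
Proof.
move=> g0 AE; have Ab t : `|t| <= 1 -> A (b + t *: g) by rewrite AE; exists t.
split; first by exists (b + 0 *: g); apply: Ab; rewrite normr0.
exists <[g]>%VS; first by rewrite dim_vline g0.
move=> V; rewrite -memvE; split.
  move=> gV x y; rewrite AE => -[t _ ->] [t' _ ->].
  by rewrite opprD addrACA subrr add0r -scalerBl memvZ.
move=> /(_ (b + 1 *: g) (b + 0 *: g)); rewrite scale0r addr0 scale1r addrAC subrr add0r.
by apply; [rewrite -[g]scale1r|rewrite -[b]addr0 -(scale0r g)];
  apply: Ab; rewrite ?normr1 ?normr0.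
Qed.

(** A face is a translate of the zonotope of the generators orthogonal to its
    direction [c].  If it is a segment, these generators are parallel, so there
    is exactly one as [gs] is reduced; conversely [wall_direction] isolates each
    generator. *)
Lemma Gen_zono gs : reduced gs -> Gen (zono gs) = pm gs.
Proof.
move=> red; have [u n0 np] := red; apply/seteqP; split=> r.
- move=> [r0 [F [b [[[c [h [ub FE]]] [[x0 Fx0] _]] trE]]]].
  have hE : supp gs c = h.
    have := Fx0; rewrite FE => -[zx0 x0c]; apply/eqP; rewrite eq_le.
    rewrite -{2}x0c (zonoP _ _).1 // andbT -dot_vert; exact/ub/zono_vert.
  have FP x : F x <-> zono [seq g <- gs | dot g c == 0] (x - vert gs c).
    by rewrite -zono_faceP FE hE.
  set L := filter _ _ in FP.
  have uL : uniq L by exact: filter_uniq.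
  have Lsub g : g \in L -> g \in gs by rewrite mem_filter => /andP[].
  clearbody L.
  have trP x : F x <-> exists2 t : R, `|t| <= 1 & x + b = t *: r.
    rewrite -conv_hull_opp trE; split=> [Fx|[y Fy /addIr <- //]]; by exists x.
  have F0 : F (vert gs c) by rewrite FP subrr; exact: zono0.
  (* The points [vert gs c] and [g + vert gs c] of the face differ by [g]. *)
  have Lr g : g \in L -> exists2 k : R, k != 0 & r = k *: g.
    move=> gL; have Fg : F (g + vert gs c) by rewrite FP addrK; exact: zono_gen.
    have [t1 _ e1] := (trP _).1 Fg; have [t2 _ e2] := (trP _).1 F0.
    have gE : g = (t1 - t2) *: r.
      by rewrite scalerBl -e1 -e2 opprD addrACA subrr addr0 addrK.
    have g0 : g != 0.
      by apply: contraNneq n0 => <-; exact: Lsub.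
    have k0 : t1 - t2 != 0 by apply: contraNneq g0 => k0; rewrite gE k0 scale0r.
    by exists (t1 - t2)^-1; rewrite ?invr_eq0 // gE scalerA mulVf // scale1r.
  have [g LE] : exists g, L = [:: g].
    case: L uL Lsub FP Lr => [|g [|g' L']] uL Lsub FP Lr.
    + have FE1 x : F x -> x = vert gs c.
        by move=> /FP /= /eqP; rewrite subr_eq0 => /eqP.
      have Fm k : `|k| <= 1 -> k *: r - b = vert gs c.
        by move=> k1; apply/FE1/trP; exists k => //; rewrite subrK.
      have /addIr : 1 *: r - b = 0 *: r - b by rewrite !Fm ?normr1 ?normr0.
      by rewrite scale1r scale0r => r00; rewrite r00 eqxx in r0.
    + by exists g.
    + have [k k0 rk] := Lr g (mem_head _ _).
      have [|k' k'0 rk'] := Lr g'; first by rewrite !inE eqxx orbT.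
      suff : g' = g.
        by move=> gg; move: uL; rewrite gg /= inE eqxx.
      apply: (np _ _ (k'^-1 * k)); rewrite ?Lsub ?inE ?eqxx ?orbT //.
      by rewrite -scalerA -rk rk' scalerA mulVf // scale1r.
  have ggs : g \in gs.
    by apply: Lsub; rewrite LE mem_head.
  have [|->|->] := @segment_length r g (vert gs c + b) r0.
  + apply/seteqP; split=> x /=.
      move=> [t t1 xE]; have : F (x - b) by apply/trP; exists t; rewrite ?subrK.
      rewrite FP LE => /zono1E[t' t1' e]; exists t' => //.
      by rewrite -e; apply/colP => i; rewrite !mxE; ring.
    move=> [t t1 ->].
    suff /trP : F (vert gs c + t *: g).
      by move=> [t' t1' e]; exists t' => //; rewrite addrAC.
    by rewrite FP addrC addKr LE; apply/zono1E; exists t.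
  + exact: pm_gen.
  + exact/pmN/pm_gen.
- move=> pr; have [c rc only] := wall_direction red pr.
  have [g gr LE] := filter_wall red pr rc only.
  have r0 := pm_neq0 n0 pr.
  have g0 : g != 0 by case: gr => -> //; rewrite oppr_eq0.
  split=> //; exists (zono gs `&` [set x | dot x c = supp gs c]), (- vert gs c).
  set F := _ `&` _.
  have FP x : F x <-> exists2 t : R, `|t| <= 1 & x - vert gs c = t *: g.
    by rewrite -zono1E -LE -zono_faceP.
  split; first split.
  + by exists c, (supp gs c); split=> // x /zonoP.
  + apply: (dim_line (b := vert gs c) g0); apply/seteqP; split=> x.
      by move=> /FP[t t1 e]; exists t => //; rewrite -e addrC subrK.
    by move=> [t t1 ->]; apply/FP; exists t => //; rewrite addrC addKr.
  + have rg (t : R) : `|t| <= 1 -> exists2 t' : R, `|t'| <= 1 & t *: r = t' *: g.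
      case: gr => -> t1; [exists t|exists (- t)] => //; rewrite ?normrN //.
      by rewrite scaleNr scalerN opprK.
    have gr' (t : R) : `|t| <= 1 -> exists2 t' : R, `|t'| <= 1 & t *: g = t' *: r.
      case: gr => -> t1; [exists t|exists (- t)] => //; rewrite ?normrN //.
      by rewrite scaleNr scalerN.
    apply/seteqP; split=> x.
      move=> /conv_hull_opp[t t1 ->]; exists (t *: r + vert gs c); last by rewrite addrK.
      by apply/FP; rewrite addrK; exact: rg.
    by move=> [y /FP[t t1 ->] <-]; apply/conv_hull_opp; exact: gr'.
Qed.

End Generators.

(** * Semi-stars *)

Section SemiStars.
Context {R : realType} {d : nat}.
Notation vec := 'cV[R]_d.
Notation mx := 'M[R]_d.
Implicit Types (u v w x y c p r s g h b : vec) (T : mx) (L gs : seq vec).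

Definition star gs c : set vec := [set r | pm gs r /\ 0 < dot r c].

Lemma semi_star_pm gs S : semi_star (pm gs) S ->
  exists2 c, generic gs c & S = star gs c.
Proof.
move=> /(semi_starP _ (finite_pm gs)) [|c [_ nc ->]]; first exact: pmN.
by exists c => // g /pm_gen; exact: nc.
Qed.

Lemma star_semi_star gs c g : g \in gs -> generic gs c ->
  semi_star (pm gs) (star gs c).
Proof.
move=> ggs gen; apply/(semi_starP _ (finite_pm gs)); first exact: pmN.
exists c; split=> // [|r]; last exact: dot_pm_generic.
by apply: contraNneq (gen g ggs) => ->; rewrite dot0r.
Qed.

Lemma eq_star gs c c' :
  (forall g, g \in gs -> Num.sg (dot g c) = Num.sg (dot g c')) ->
  star gs c = star gs c'.
Proof.
move=> e; have e' r : pm gs r -> (0 < dot r c) = (0 < dot r c').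
  rewrite -!sgr_cp0 => /orP[/e -> //|/e]; rewrite !dotNl !sgrN => /oppr_inj ->.
  by [].
by apply/seteqP; split=> r [pr]; rewrite /star /= ?e' // -?e'.
Qed.

Lemma star_orthogonal gs c T : orthogonal_group T ->
  mximage T (pm gs) = pm gs -> mximage T (star gs c) = star gs (T *m c).
Proof.
move=> oT Tpm; apply/seteqP; split=> x.
  move=> [y [py yc] <-]; split; last by rewrite dot_orthogonal.
  by rewrite -Tpm; exists y.
move=> []; rewrite -{1}Tpm => -[y py <-]; rewrite dot_orthogonal // => yc.
by exists y.
Qed.

Lemma reduced_map gs T : orthogonal_group T -> reduced gs ->
  reduced (map (mulmx T) gs).
Proof.
move=> oT [u n0 np]; have injT : injective (fun x : vec => T *m x).
  by move=> x y e; rewrite -(orthogonalK x oT) e orthogonalK.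
split; first by rewrite map_inj_uniq.
  apply/mapP => -[x xgs /esym e]; move: n0; suff <- : x = 0 by rewrite xgs.
  by apply: injT; rewrite e mulmx0.
move=> g h k /mapP[g' gg ->] /mapP[h' hh ->]; rewrite scalemxAr => /injT e.
by rewrite (np g' h' k).
Qed.

Lemma pm_map gs T : orthogonal_group T ->
  pm (map (mulmx T) gs) = mximage T (pm gs).
Proof.
move=> oT; apply/seteqP; split=> r.
  move=> /orP[]/mapP[g ggs e]; first by exists g; [exact: pm_gen|].
  by exists (- g); [exact/pmN/pm_gen|rewrite mulmxN -e opprK].
move=> [s /orP[] sgs <-]; rewrite /pm /=; first by rewrite map_f.
by rewrite -mulmxN orbC map_f.
Qed.

(** The generators depend on the zonotope only, and [T] maps generators of [Z]
    to generators of [T Z]. *)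
Lemma pm_symmetry gs T : orthogonal_group T -> reduced gs ->
  mximage T (zono gs) = zono gs -> mximage T (pm gs) = pm gs.
Proof.
move=> oT red e; rewrite -pm_map // -Gen_zono; last exact: reduced_map.
by rewrite -zono_map // e Gen_zono.
Qed.

(** A vertex determines the semi-star of the directions in which it is
    maximal, and a symmetry carries this correspondence along. *)
Lemma vertex_transitive_congruent gs S S' : reduced gs ->
  vertex_transitive (zono gs) ->
  semi_star (pm gs) S -> semi_star (pm gs) S' -> congruent S S'.
Proof.
move=> red [_ trans] /semi_star_pm[c gen ->] /semi_star_pm[c' gen' ->].
have [_ n0 _] := red.
have [||T [oT TZ] Tv] := trans (vert gs c) (vert gs c').
- by apply/vertices_zono => //; exists c.
- by apply/vertices_zono => //; exists c'.
exists T => //; have [genT vT] := generic_orthogonal oT TZ n0 gen.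
rewrite star_orthogonal //; last exact: pm_symmetry.
by apply: eq_star; apply: vert_sign => //; rewrite -vT.
Qed.

(** * Congruence of semi-stars forces reflections *)

(** The semi-star of a generic [c], with one vector for each generator. *)
Definition star_seq gs c := [seq Num.sg (dot g c) *: g | g <- gs].

Lemma mem_star_seq gs c r : reduced gs -> generic gs c ->
  (r \in star_seq gs c) <-> star gs c r.
Proof.
move=> red gen; split.
  move=> /mapP[g ggs ->]; split; last first.
    by rewrite dotZl -normrEsg normr_gt0 gen.
  case: sgrP => h; first by have := gen g ggs; rewrite h eqxx.
    by rewrite scale1r; exact: pm_gen.
  by rewrite scaleN1r; exact/pmN/pm_gen.
move=> [/orP[] rg rc]; apply/mapP; [exists r|exists (- r)] => //.
  by rewrite gtr0_sg ?scale1r.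
by rewrite dotNl sgrN gtr0_sg // scaleNr scale1r opprK.
Qed.

Lemma uniq_star_seq gs c : reduced gs -> generic gs c -> uniq (star_seq gs c).
Proof.
move=> [u _ np] gen; rewrite map_inj_in_uniq // => g h ggs hgs e.
symmetry; apply: (np _ _ (Num.sg (dot h c) * Num.sg (dot g c))) => //.
by rewrite -scalerA e scalerA -expr2 sqr_sg gen // scale1r.
Qed.

(** The data used here are symmetric in [a] and [b] and invariant under
    orthogonal maps, yet for fixed [a] they determine [|b|] and [<a, b>]. *)
Definition pair_type (k z : R) (a b : vec) : nat :=
  (dot a a + dot b b == k) && (dot a b == z).

Definition pair_count k z (l : seq vec) : nat :=
  \sum_(a <- l) \sum_(b <- l) pair_type k z a b.

Lemma pair_typeC k z a b : pair_type k z a b = pair_type k z b a.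
Proof. by rewrite /pair_type dotC addrC. Qed.

Lemma pair_typeNl k z a b : pair_type k z (- a) b = pair_type k z a (- b).
Proof. by rewrite /pair_type !dotNl !dotNr !opprK. Qed.

Lemma perm_pair_count k z l l' : perm_eq l l' ->
  pair_count k z l = pair_count k z l'.
Proof.
move=> e; rewrite /pair_count (perm_big _ e) /=.
by apply: eq_bigr => a _; apply: perm_big.
Qed.

Lemma pair_count_map k z l T : orthogonal_group T ->
  pair_count k z (map (mulmx T) l) = pair_count k z l.
Proof.
move=> oT; rewrite /pair_count big_map; apply: eq_bigr => a _.
by rewrite big_map; apply: eq_bigr => b _; rewrite /pair_type !dot_orthogonal.
Qed.

Lemma congruent_pair_count gs c c' k z : reduced gs ->
  generic gs c -> generic gs c' -> congruent (star gs c) (star gs c') ->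
  pair_count k z (star_seq gs c) = pair_count k z (star_seq gs c').
Proof.
move=> red gen gen' [T oT e]; rewrite -(pair_count_map k z _ oT).
apply: perm_pair_count; apply: uniq_perm; last 1 first.
- move=> x; apply/idP/idP.
    move=> /mapP[y /(mem_star_seq _ red gen) sy ->].
    by apply/(mem_star_seq _ red gen'); rewrite -e; exists y.
  move=> /(mem_star_seq _ red gen'); rewrite -e => -[y sy <-].
  by apply: map_f; apply/mem_star_seq.
- rewrite map_inj_uniq; first exact: uniq_star_seq.
  by move=> x y h; rewrite -(orthogonalK x oT) h orthogonalK.
- exact: uniq_star_seq.
Qed.

Lemma pair_count_cons k z r l :
  (pair_count k z (r :: l) =
   pair_type k z r r + 2 * (\sum_(b <- l) pair_type k z r b) + pair_count k z l)%N.
Proof.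
rewrite /pair_count !big_cons -addnA -addnA; congr (_ + _)%N.
under [X in (_ + X = _)%N]eq_bigr => a _ do rewrite big_cons pair_typeC.
by rewrite big_split /= addnA mulSn mul1n.
Qed.

Definition all_congruent gs := forall S S',
  semi_star (pm gs) S -> semi_star (pm gs) S' -> congruent S S'.

(** The semi-stars on the two sides of the wall [r] differ in the sign of [r]
    only.  As they are congruent they have the same pairs of each type; after
    cancelling the pairs without [r], this compares the vectors seen from
    [r] with those seen from [- r]. *)
Lemma wall_balance gs p r k z : reduced gs -> all_congruent gs ->
  pm gs r -> dot r p = 0 ->
  (forall g, pm gs g -> dot g p = 0 -> g = r \/ g = - r) ->
  (\sum_(g <- gs | dot g p != 0%R) pair_type k z r (Num.sg (dot g p) *: g) =
   \sum_(g <- gs | dot g p != 0%R) pair_type k z (- r) (Num.sg (dot g p) *: g))%N.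
Proof.
move=> red cong pr rp only; have [_ n0 _] := red; have r0 := pm_neq0 n0 pr.
have [g0 g0r fE] := filter_wall red pr rp only.
pose L := [seq Num.sg (dot g p) *: g | g <- gs & dot g p != 0].
have sumL f : (\sum_(g <- gs | dot g p != 0%R) f (Num.sg (dot g p) *: g) =
    \sum_(b <- L) f b)%N by rewrite big_map big_filter.
have side q : q = r \/ q = - r -> exists2 c, generic gs c &
    perm_eq (star_seq gs c) (q :: L).
  move=> qr; have [e e0 he] := lex_direction gs p q; exists (p + e *: q).
    move=> g ggs; rewrite -sgr_eq0 he //; case: ifPn => gp; rewrite sgr_eq0 //.
    have := only g (pm_gen ggs) (eqP gp).
    by case: qr => -> [] ->; rewrite ?dotNl ?dotNr ?oppr_eq0 dot_eq0.
  have pe : perm_eq gs ([seq g <- gs | dot g p == 0] ++ [seq g <- gs | dot g p != 0]).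
    by rewrite perm_sym; apply/permPl/perm_filterC.
  apply: (perm_trans (perm_map _ pe)); rewrite fE /=.
  have g0gs : g0 \in gs.
    by have := mem_head g0 [::]; rewrite -fE mem_filter => /andP[].
  have g0p : dot g0 p == 0.
    by have := mem_head g0 [::]; rewrite -fE mem_filter => /andP[].
  have rr : Num.sg (dot r r) = 1 by rewrite gtr0_sg // dot_gt0.
  have -> : Num.sg (dot g0 (p + e *: q)) *: g0 = q.
    rewrite he // g0p.
    by case: g0r qr => -> [] ->; rewrite ?dotNl ?dotNr ?opprK ?sgrN rr;
      rewrite ?scaleNr ?scale1r ?opprK.
  rewrite perm_cons (_ : map _ _ = L) //; apply/eq_in_map => g.
  by rewrite mem_filter /= => /andP[gp ggs]; rewrite he // (negPf gp).
have [c gen pe] := side r (or_introl erefl).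
have [c' gen' pe'] := side (- r) (or_intror erefl).
have ggs : exists g, g \in gs by case/orP: pr => h; eexists; exact: h.
have [g ggs'] := ggs.
have := congruent_pair_count k z red gen gen'
  (cong _ _ (star_semi_star ggs' gen) (star_semi_star ggs' gen')).
rewrite (perm_pair_count k z pe) (perm_pair_count k z pe') !pair_count_cons.
rewrite pair_typeNl opprK => /eqP; rewrite eqn_add2r eqn_add2l eqn_pmul2l //.
by rewrite !sumL => /eqP.
Qed.

Lemma dot_plane r t (a b : R) : dot t r = 0 ->
  dot (a *: t + b *: r) (a *: t + b *: r) = a ^+ 2 * dot t t + b ^+ 2 * dot r r.
Proof. by move=> tr; rewrite !dot_linear (dotC r t) tr; ring. Qed.

(** Let [p] be generic in the orthogonal complement of the plane of [r] and [s],
    and let [t] be the component of [s] orthogonal to [r].  Comparing the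
    balances at the walls of [r] close to [p + e t] and [p - e t] cancels the
    vectors outside the plane.  So the vectors of the plane on the side of [t]
    are balanced, and there a vector is determined by its length and its product
    with [r]: the mirror image of [s] must occur. *)
Lemma all_congruent_reflection gs r s : reduced gs -> all_congruent gs ->
  pm gs r -> pm gs s -> pm gs (reflection r *m s).
Proof.
move=> red cong pr ps; have [_ n0 _] := red; have r0 := pm_neq0 n0 pr.
pose t := perp r s.
have [t0|t0] := eqVneq t 0.
  have sE : s = (dot s r / dot r r) *: r by rewrite {1}(perpE r s) -/t t0 add0r.
  suff -> : reflection r *m s = - s by exact: pmN.
  by rewrite {1}sE -scalemxAr reflection_self scalerN -sE.
have tr : dot t r = 0 by exact: dot_perp.
pose out x := perp t (perp r x).
have dot_out x c : dot r c = 0 -> dot t c = 0 -> dot x c = dot (out x) c.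
  move=> rc tc; rewrite {1}(perpE r x) {1}(perpE t (perp r x)).
  by rewrite 2!dotDl 2!dotZl rc tc !mulr0 !addr0.
have out_r x : dot r (out x) = 0.
  by rewrite /out perp_dot ?(dotC r t) // dotC dot_perp.
have out_t x : dot t (out x) = 0 by rewrite dotC dot_perp.
have [||x|p [/= rp tp] gen] := @generic_direction R d
    [set c | dot r c = 0 /\ dot t c = 0] [seq g <- gs | out g != 0] 0.
- move=> u v e /= [ru tu] [rv tv].
  by rewrite !(dotDr, dotZr) ru rv tu tv mulr0 addr0.
- by rewrite /= !dot0r.
- rewrite mem_filter => /andP[x0 _]; exists (out x); first by split.
  by rewrite dot_out // dot_eq0.
have inplane g : g \in gs -> dot g p = 0 -> out g = 0.
  move=> ggs gp; apply/eqP/negPn/negP => h.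
  by have [] := gen g; rewrite ?mem_filter ?h // gp eqxx.
have onlyr g : g \in gs -> dot g p = 0 -> dot g t = 0 -> g = r \/ g = - r.
  move=> ggs gp gt; have : perp r g = 0.
    have := inplane g ggs gp; rewrite /out {1}/perp.
    have -> : dot (perp r g) t = 0.
      by rewrite dotC perp_dot // dotC.
    by rewrite mul0r scale0r subr0.
  move/eqP; rewrite subr_eq0 => /eqP; exact: pm_parallel red pr (pm_gen ggs).
(* The balance at the wall of [r] next to [p + e q], for [q] equal to [t] or
   [- t], with the generators inside and outside the plane separated. *)
have balance k z q : q = t \/ q = - t ->
    (\sum_(g <- gs | dot g p != 0%R) pair_type k z r (Num.sg (dot g p) *: g) +
     \sum_(g <- gs | (dot g p == 0%R) && (dot g t != 0%R))
        pair_type k z r (Num.sg (dot g q) *: g) =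
     \sum_(g <- gs | dot g p != 0%R) pair_type k z (- r) (Num.sg (dot g p) *: g) +
     \sum_(g <- gs | (dot g p == 0%R) && (dot g t != 0%R))
        pair_type k z (- r) (Num.sg (dot g q) *: g))%N.
  move=> qt; have [e e0 he] := lex_direction gs p q.
  have qg g : (dot g q == 0) = (dot g t == 0).
    by case: qt => ->; rewrite ?dotNr ?oppr_eq0.
  have zero g : g \in gs -> (dot g (p + e *: q) == 0) = (dot g p == 0) && (dot g t == 0).
    move=> ggs; rewrite -sgr_eq0 he //; case: ifPn => gp; rewrite sgr_eq0 ?qg //.
    exact: negPf.
  have split_sum (f : vec -> nat) :
      (\sum_(g <- gs | dot g (p + e *: q) != 0%R) f (Num.sg (dot g (p + e *: q)) *: g) =
       \sum_(g <- gs | dot g p != 0%R) f (Num.sg (dot g p) *: g) +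
       \sum_(g <- gs | (dot g p == 0%R) && (dot g t != 0%R)) f (Num.sg (dot g q) *: g))%N.
    rewrite (bigID (fun g => dot g p != 0)) /=; congr (_ + _)%N.
      rewrite big_seq_cond [RHS]big_seq_cond; apply: eq_big => g.
        by case ggs: (g \in gs) => //=; rewrite zero //; case: eqP; rewrite ?andbF.
      by move=> /andP[ggs /andP[_ gp]]; rewrite he // (negPf gp).
    rewrite big_seq_cond [RHS]big_seq_cond; apply: eq_big => g.
      by case ggs: (g \in gs) => //=; rewrite zero //; case: eqP; rewrite ?andbF ?andbT.
    by move=> /andP[ggs /andP[_ /negPn gp]]; rewrite he // gp.
  rewrite -!split_sum; apply: wall_balance => //.
    rewrite dotDr dotZr rp add0r; apply/eqP.
    by rewrite mulf_eq0 qg dotC tr eqxx orbT.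
  move=> g /orP[] ggs; first by move/eqP; rewrite zero // => /andP[/eqP gp /eqP gt]; exact: onlyr.
  move=> h; have /eqP : dot (- g) (p + e *: q) = 0 by rewrite dotNl h oppr0.
  rewrite zero // => /andP[/eqP gp /eqP gt].
  by case: (onlyr _ ggs gp gt) => /(congr1 -%R); rewrite opprK ?opprK; [right|left].
pose k := dot r r + dot s s; pose z := dot r s.
pose B a := (\sum_(g <- gs | (dot g p == 0%R) && (dot g t != 0%R))
  pair_type k z a (Num.sg (dot g t) *: g))%N.
have BE : B r = B (- r).
  have := balance k z t (or_introl erefl); rewrite -/(B r) -/(B (- r)).
  have := balance k z (- t) (or_intror erefl).
  have swap a : (\sum_(g <- gs | (dot g p == 0%R) && (dot g t != 0%R))
      pair_type k z a (Num.sg (dot g (- t)) *: g))%N = B (- a).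
    by apply: eq_bigr => g _; rewrite dotNr sgrN scaleNr -pair_typeNl.
  rewrite !swap opprK; lia.
have ts : dot s t = dot t t.
  by rewrite {1}(perpE r s) dotDl dotZl -/t (dotC r) tr mulr0 addr0.
have tt0 : 0 < dot t t by rewrite dot_gt0.
have [g [ggs gp gt gE]] : exists g, [/\ g \in gs, dot g p = 0, dot g t != 0 &
    Num.sg (dot g t) *: g = s].
  have sp : dot s p = 0.
    by rewrite (perpE r s) -/t dotDl dotZl rp tp mulr0 addr0.
  case/orP: ps => sgs.
    by exists s; rewrite ts gtr0_sg // gt_eqF // scale1r.
  exists (- s); rewrite !dotNl ts sp oppr0 oppr_eq0 sgrN gtr0_sg //.
  by rewrite gt_eqF // scaleN1r opprK.
have Bpos : (0 < B (- r))%N.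
  rewrite -BE /B (perm_big _ (perm_to_rem ggs)) big_cons gp gt eqxx /= gE.
  by rewrite /pair_type !eqxx.
have [h [hgs hp ht /andP[/eqP hn /eqP hr]]] : exists h, [/\ h \in gs, dot h p = 0, dot h t != 0 &
    (dot (- r) (- r) + dot (Num.sg (dot h t) *: h) (Num.sg (dot h t) *: h) == k) &&
    (dot (- r) (Num.sg (dot h t) *: h) == z)].
  apply: contrapT => no; move: Bpos; rewrite /B big_seq_cond big1 //.
  move=> h /andP[hgs /andP[/eqP hp ht]]; apply/eqP; rewrite eqb0; apply/negP => hk.
  by apply: no; exists h.
set b := _ *: h in hn hr.
have pb : pm gs b.
  rewrite /b; case: sgrP ht => //= _ _; first by rewrite scale1r; exact: pm_gen.
  by rewrite scaleN1r; exact/pmN/pm_gen.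
suff -> : reflection r *m s = b by [].
have bt : 0 < dot b t by rewrite /b dotZl -normrEsg normr_gt0.
have ob : out b = 0.
  by have := inplane h hgs hp; rewrite /out /b !perpZ => ->; rewrite scaler0.
have bE : b = (dot (perp r b) t / dot t t) *: t + (dot b r / dot r r) *: r.
  rewrite {1}(perpE r b); congr (_ + _).
  by move/eqP: ob; rewrite subr_eq0 => /eqP.
have sE : s = t + (dot s r / dot r r) *: r by exact: perpE.
set be := (X in X *: t) in bE.
have rr0 : dot r r != 0 by rewrite dot_eq0.
have br : dot b r = - dot s r by rewrite (dotC b) (dotC s) -/z -hr dotNl opprK.
have be2 : be * be = 1.
  have ss : dot b b = dot s s.
    by move: hn; rewrite /k dotNl dotNr opprK => /addrI.
  have bb : dot b b = be ^+ 2 * dot t t + (dot b r / dot r r) ^+ 2 * dot r r.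
    by rewrite {1 2}bE dot_plane.
  have := ss; rewrite bb {1 2}sE -[t in RHS]scale1r dot_plane // br mulNr sqrrN.
  by move/addIr/(mulIf (lt0r_neq0 tt0)); rewrite expr1n expr2.
have be0 : 0 < be.
  by move: bt; rewrite bE dotDl 2!dotZl (dotC r t) tr mulr0 addr0 pmulr_lgt0.
have be1 : be = 1 by nra.
rewrite reflectionE bE be1 scale1r br {1}sE (dotC r s).
by apply/colP => i; rewrite !mxE; ring.
Qed.

End SemiStars.

(** * The symmetry group of the generators *)

Section RootSystem.
Context {R : realType} {d : nat}.
Notation vec := 'cV[R]_d.
Notation mx := 'M[R]_d.
Implicit Types (u v x y c p r s g h : vec) (T : mx) (L gs w : seq vec).
Implicit Types G : set mx.

Definition pm_seq gs := gs ++ map -%R gs.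

Lemma mem_pm_seq gs r : (r \in pm_seq gs) <-> pm gs r.
Proof.
rewrite /pm /= mem_cat; split=> /orP[->//|h]; apply/orP; right.
  by case/mapP: h => g ggs ->; rewrite opprK.
by rewrite -[r]opprK map_f.
Qed.

Lemma uniq_pm_seq gs : reduced gs -> uniq (pm_seq gs).
Proof.
move=> [u n0 np]; rewrite cat_uniq u map_inj_uniq ?u ?andbT; last exact: oppr_inj.
apply/hasPn => x /mapP[g ggs ->]; apply/negP => ngs.
have /esym gE : - g = g by apply: (np _ _ (-1)) => //; rewrite scaleN1r.
move/eqP: gE; rewrite -addr_eq0 -mulr2n -scaler_nat scaler_eq0 pnatr_eq0 /=.
by move/eqP => g0; rewrite g0 in ggs; rewrite ggs in n0.
Qed.

(** The list of all generators and their opposites counts each generator twice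
    in the support function, and this list depends on [pm gs] only, up to order. *)
Lemma eq_pm_supp gs gs' : reduced gs -> reduced gs' -> pm gs = pm gs' ->
  supp gs =1 supp gs'.
Proof.
move=> red red' e c.
have dbl l : supp (pm_seq l) c = supp l c *+ 2.
  rewrite /supp big_cat big_map /= mulr2n; congr (_ + _).
  by apply: eq_bigr => g _; rewrite dotNl normrN.
have pe : perm_eq (pm_seq gs) (pm_seq gs').
  apply: uniq_perm; [exact: uniq_pm_seq|exact: uniq_pm_seq|].
  by move=> x; apply/idP/idP => /mem_pm_seq h; apply/mem_pm_seq; rewrite ?e // -e.
have : supp gs c *+ 2 = supp gs' c *+ 2 by rewrite -!dbl /supp (perm_big _ pe).
by move/eqP; rewrite eqr_pMn2r // => /eqP.
Qed.

Lemma pm_symmetry_zono gs T : orthogonal_group T -> reduced gs ->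
  mximage T (pm gs) = pm gs -> mximage T (zono gs) = zono gs.
Proof.
move=> oT red e; rewrite zono_map //; apply: eq_supp_zono.
by apply: eq_pm_supp => //; [exact: reduced_map|rewrite pm_map].
Qed.

Definition pm_group gs : set mx :=
  [set T | orthogonal_group T /\ mximage T (pm gs) = pm gs].

Lemma mximage_mul T T' (A : set vec) :
  mximage (T *m T') A = mximage T (mximage T' A).
Proof.
apply/seteqP; split=> x; first by move=> [y Ay <-]; exists (T' *m y); [exists y|rewrite mulmxA].
by move=> [_ [y Ay <-] <-]; exists y => //; rewrite mulmxA.
Qed.

Lemma mximage1 (A : set vec) : mximage 1%:M A = A.
Proof.
apply/seteqP; split=> x; first by move=> [y Ay <-]; rewrite mul1mx.
by move=> Ax; exists x => //; rewrite mul1mx.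
Qed.

Lemma orthogonal_subgroupT : orthogonal_subgroup (@orthogonal_group R d).
Proof.
split=> //.
- by rewrite /orthogonal_group /= trmx1 mul1mx.
- move=> T T' oT oT'; rewrite /orthogonal_group /= trmx_mul.
  by rewrite mulmxA -(mulmxA _ T^T) oT mulmx1 oT'.
- by move=> T oT; rewrite orthogonal_inv //; exact: orthogonal_trmx.
Qed.

Lemma pm_group_subgroup gs : orthogonal_subgroup (pm_group gs).
Proof.
have [_ o1 oM oV] := orthogonal_subgroupT; split.
- by move=> T [].
- by split=> //; rewrite mximage1.
- move=> T T' [oT e] [oT' e']; split; first exact: oM.
  by rewrite mximage_mul e' e.
- move=> T [oT e]; split; first exact: oV.
  by rewrite orthogonal_inv // -{1}e -mximage_mul oT mximage1.
Qed.

Definition spanning gs := forall u, (forall g, g \in gs -> dot g u = 0) -> u = 0.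

(** If every generator is orthogonal to [u] then so is every difference of points
    of the zonotope, while these differences span the whole space. *)
Lemma full_dimensional_spanning gs :
  full_dimensional (zono gs) -> spanning gs.
Proof.
move=> [_ [U dimU UV]] u gu.
have U1 : U = fullv.
  by apply/eqP; rewrite eqEdim subvf dimU dimvf /= /dim /= ?muln1.
have su : supp gs u = 0.
  by rewrite /supp big_seq_cond big1 // => g /andP[/gu -> _]; rewrite normr0.
have zu x : zono gs x -> dot x u = 0.
  move=> zx; apply/eqP; rewrite eq_le.
  have /zonoP/(_ u) := zx; have /zonoP/(_ u) := zonoN zx.
  by rewrite su dotNl oppr_le0 => -> ->.
pose V := lker (linfun (mulmx u^T : vec -> 'M[R]_1)).
have : (U <= V)%VS.
  apply/UV => x y zx zy; rewrite memv_ker lfunE /=; apply/eqP.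
  apply/matrixP => i j; rewrite !ord1 [RHS]mxE.
  by have : dot u (x - y) = 0 by rewrite dotC dotDl dotNl !zu // subrr.
rewrite U1 => /subvP/(_ u (memvf _)); rewrite memv_ker lfunE /= => /eqP h.
by apply/eqP; rewrite -dot_eq0 /dot h mxE.
Qed.

(** A linear map is determined by its values on the spanning list [gs], and these
    are taken in a finite set. *)
Lemma finite_pm_group gs : spanning gs -> finite_set (pm_group gs).
Proof.
move=> sp.
pose F T := [ffun i : 'I_(size gs) =>
  (inord (index (T *m gs`_i) (pm_seq gs)) : 'I_(size (pm_seq gs)).+1)].
have FE T i : pm_group gs T -> nth 0 (pm_seq gs) (F T i) = T *m gs`_i.
  move=> [_ e]; rewrite ffunE.
  have h : T *m gs`_i \in pm_seq gs.
    by apply/mem_pm_seq; rewrite -e; exists gs`_i => //; apply/pm_gen/mem_nth.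
  by rewrite inordK ?nth_index // ltnS ltnW // index_mem.
rewrite -(eq_finite_set (inj_card_eq (f := F) _)); first exact: finite_finset.
move=> T T' /set_mem GT /set_mem GT' e.
have eg g : g \in gs -> T *m g = T' *m g.
  move=> ggs; have lt : (index g gs < size gs)%N by rewrite index_mem.
  by have := FE T (Ordinal lt) GT; rewrite e FE //= nth_index.
have [[oT _] [oT' _]] := (GT, GT').
apply: trmx_inj; apply/matrixP => i j.
have col0 : T^T *m delta_mx j (0 : 'I_1) - T'^T *m delta_mx j 0 = 0.
  apply: sp => g ggs; rewrite dotDr dotNr -!dot_mulmx.
  by rewrite eg // subrr.
move/colP/(_ i): col0; rewrite -!colE !mxE => /eqP.
by rewrite subr_eq0 => /eqP.
Qed.

(** * Regularity of the action of a reflection group on chambers *)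

Lemma exists_argmin (I : eqType) (f : I -> R) (l : seq I) (x0 : I) : x0 \in l ->
  exists2 i, i \in l & forall j, j \in l -> f i <= f j.
Proof.
elim: l x0 => // a [|b l] IH x0 _.
  by exists a; rewrite ?mem_head // => y; rewrite inE => /eqP->.
have [x xl xmin] := IH b (mem_head _ _).
have [ax|xa] := leP (f a) (f x).
  exists a; first exact: mem_head.
  move=> y; rewrite inE => /orP[/eqP->//|yl].
  exact: le_trans ax (xmin y yl).
exists x; first by rewrite inE xl orbT.
by move=> y; rewrite inE => /orP[/eqP->|/xmin //]; exact: ltW.
Qed.

Definition reflection_closed gs := forall r s,
  pm gs r -> pm gs s -> pm gs (reflection r *m s).

(** The simple roots of the positive system [star gs c], encoded by their
    exchange property. *)
Definition simple gs c s := star gs c s /\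
  forall x, star gs c x -> x <> s -> star gs c (reflection s *m x).

Lemma pm_star gs c r : generic gs c -> pm gs r -> star gs c r \/ star gs c (- r).
Proof.
move=> gen pr; have := dot_pm_generic gen pr; rewrite neq_lt => /orP[h|h].
  by right; split; [exact: pmN|rewrite dotNl oppr_gt0].
by left.
Qed.

(** Here [p] is a point in the relative interior of the wall of [s]: the reflection
    of [s] fixes it, so it preserves the set of roots positive on [p]. *)
Lemma simple_wall gs c s p : reflection_closed gs -> generic gs c ->
  star gs c s -> dot s p = 0 ->
  (forall x, star gs c x -> x <> s -> 0 < dot x p) -> simple gs c s.
Proof.
move=> rc gen ss sp pos; split=> // x sx xs.
have y0 : 0 < dot (reflection s *m x) p.
  by rewrite dot_reflection reflection_fix // pos.
have py : pm gs (reflection s *m x) by case: ss sx => ps _ [px _]; exact: rc.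
have [//|ny] := pm_star gen py.
have [e|/eqP e] := eqVneq (- (reflection s *m x)) s.
  by move: y0; rewrite -[X in dot X _]opprK e dotNl sp oppr0 ltxx.
by have := pos _ ny e; rewrite dotNl oppr_gt0 => /(lt_trans y0); rewrite ltxx.
Qed.

(** On a segment from [c'] to [c], perturbed so that no two hyperplanes are crossed
    at once, the last hyperplane crossed is a wall of the chamber of [c].  The
    hyperplane of [x] is crossed the later the smaller [<x, c'> / <x, c>] is, so
    the last one belongs to the minimal ratio. *)
Lemma separating_simple gs c c' : reduced gs -> reflection_closed gs ->
  generic gs c -> generic gs c' ->
  (exists2 g, star gs c g & dot g c' < 0) ->
  exists2 s, simple gs c s & dot s c' < 0.
Proof.
move=> red rc gen gen' [r sr rneg]; have [_ n0 _] := red.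
pose P := star_seq gs c.
have memP x : x \in P <-> star gs c x by exact: mem_star_seq.
pose cross x y : vec := dot y c *: x - dot x c *: y.
(* Directions not orthogonal to [cross x y] give [x] and [y] distinct ratios. *)
pose L := gs ++ [seq z <- allpairs cross P P | z != 0].
have [//|//|z|c2 _ h2] := @generic_direction R d setT L c'.
  rewrite mem_cat mem_filter => zL; exists z => //; rewrite dot_eq0.
  by case/orP: zL => [zgs|/andP[]//]; apply: contraNneq n0 => <-.
have sgn x : pm gs x -> Num.sg (dot x c2) = Num.sg (dot x c').
  move=> /orP[] xgs.
    by have [_] := h2 x ltac:(by rewrite mem_cat xgs); apply; exact: gen'.
  have [_ /(_ (gen' _ xgs))] := h2 (- x) ltac:(by rewrite mem_cat xgs).
  by rewrite !dotNl !sgrN => /oppr_inj.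
have neg2 x : pm gs x -> (dot x c2 < 0) = (dot x c' < 0).
  by move=> px; rewrite -!sgr_cp0 sgn.
pose f x := dot x c2 / dot x c.
have [s /memP ss smin] := exists_argmin f ((memP r).2 sr).
have sc : 0 < dot s c by case: ss.
have fs0 : f s < 0.
  apply: le_lt_trans (smin r ((memP r).2 sr)) _.
  case: (sr) => pr rpos; rewrite /f pmulr_llt0 ?invr_gt0 // neg2 //.
exists s; last first.
  by move: fs0; rewrite /f pmulr_llt0 ?invr_gt0 // neg2 //; case: ss.
apply: (@simple_wall _ _ _ (c2 - f s *: c)) => //.
  by rewrite dotDr dotNr dotZr /f divfK ?subrr // gt_eqF.
move=> x sx xs; have xc : 0 < dot x c by case: sx.
have fE : dot x (c2 - f s *: c) = dot x c * (f x - f s).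
  rewrite dotDr dotNr dotZr mulrBr /f (mulrC (dot x c)) divfK ?gt_eqF //.
  by rewrite (mulrC (dot x c)).
rewrite fE pmulr_rgt0 // subr_gt0 lt_neqAle smin ?andbT; last exact/memP.
have cr0 : cross x s != 0.
  rewrite subr_eq0; apply/eqP => e; case: xs.
  have xE : x = ((dot s c)^-1 * dot x c) *: s.
    by rewrite -scalerA -e scalerA mulVf ?scale1r // gt_eqF.
  have [] := pm_parallel red (proj1 ss) (proj1 sx) xE => // xN.
  by move: xc; rewrite xN dotNl oppr_gt0 => /(lt_trans sc); rewrite ltxx.
apply/eqP => e; have [|] := h2 (cross x s).
  rewrite mem_cat mem_filter cr0 orbC allpairs_f //; exact/memP.
move=> + _; rewrite /cross dotDl dotNl !dotZl.
have -> : dot s c2 = f s * dot s c by rewrite /f divfK // gt_eqF.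
have -> : dot x c2 = f x * dot x c by rewrite /f divfK // gt_eqF.
rewrite e; have -> : dot s c * (f x * dot x c) - dot x c * (f x * dot s c) = 0 by ring.
by rewrite eqxx.
Qed.

Definition word w : mx := foldr (fun s T => reflection s *m T) 1%:M w.

Lemma word_cat w w' : word (w ++ w') = word w *m word w'.
Proof. by elim: w => [|s w IH] /=; rewrite ?mul1mx // IH mulmxA. Qed.

Definition simple_words gs c : set mx :=
  [set T | exists2 w, (forall s, s \in w -> simple gs c s) & T = word w].

Section Chamber.
Variables (gs : seq vec) (c : vec).
Hypotheses (red : reduced gs) (rc : reflection_closed gs) (gen : generic gs c).

Let n0 : 0 \notin gs. Proof. by case: red. Qed.

Lemma reflection_pm_group r : pm gs r -> pm_group gs (reflection r).
Proof.
move=> pr; have r0 := pm_neq0 n0 pr; split; first exact: reflection_orth.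
apply/seteqP; split=> x; first by move=> [y py <-]; exact: rc.
by move=> px; exists (reflection r *m x); [exact: rc|rewrite reflectionK].
Qed.

Lemma simple_pm s : simple gs c s -> pm gs s.
Proof. by case=> -[]. Qed.

Lemma word_in (K : set mx) w : orthogonal_subgroup K ->
  (forall s, s \in w -> K (reflection s)) -> K (word w).
Proof.
move=> [_ K1 KM _]; elim: w => //= s w IH h.
apply: KM; first by apply: h; rewrite mem_head.
by apply: IH => r rw; apply: h; rewrite inE rw orbT.
Qed.

Lemma simple_words_pm T : simple_words gs c T -> pm_group gs T.
Proof.
move=> [w sw ->]; apply: word_in; first exact: pm_group_subgroup.
by move=> s /sw /simple_pm; exact: reflection_pm_group.
Qed.

Lemma word_rev w : (word w)^T = word (rev w).
Proof.
elim: w => [|s w IH] /=; first by rewrite trmx1.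
by rewrite trmx_mul IH rev_cons -cats1 word_cat /= mulmx1 reflection_tr.
Qed.

Lemma simple_words_subgroup : orthogonal_subgroup (simple_words gs c).
Proof.
split.
- by move=> T /simple_words_pm[].
- by exists [::].
- move=> T T' [w sw ->] [w' sw' ->]; exists (w ++ w'); last by rewrite word_cat.
  by move=> s; rewrite mem_cat => /orP[/sw|/sw'].
- move=> T HT; have [oT _] := simple_words_pm HT; rewrite orthogonal_inv //.
  case: HT => w sw ->; exists (rev w); last exact: word_rev.
  by move=> s; rewrite mem_rev; exact: sw.
Qed.

(** Among the images [T c'], the one with largest product with [c] lies in the
    chamber of [c], since a separating simple reflection would increase the
    product. *)
Lemma chamber_transitive c' : spanning gs -> generic gs c' ->
  exists2 T, simple_words gs c T & star gs (T *m c') = star gs c.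
Proof.
move=> sp gen'.
have finH : finite_set (simple_words gs c).
  exact: sub_finite_set simple_words_pm (finite_pm_group sp).
have /finite_seqP[l lE] := finH.
have memH T : T \in l <-> simple_words gs c T by rewrite lE.
have [_ H1 HM _] := simple_words_subgroup.
have [T /memH HT Tmin] :=
  exists_argmin (fun T => - dot c (T *m c')) ((memH _).2 H1).
exists T => //; have [oT Tpm] := simple_words_pm HT.
have [genT _] := generic_orthogonal oT (pm_symmetry_zono oT red Tpm) n0 gen'.
have nosep x : star gs c x -> 0 < dot x (T *m c').
  move=> sx; rewrite ltNge le_eqVlt (negPf (dot_pm_generic genT (proj1 sx))) /=.
  apply/negP => xneg.
  have [s ss sneg] := separating_simple red rc gen genT (ex_intro2 _ _ x sx xneg).
  have s0 := pm_neq0 n0 (simple_pm ss).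
  have HsT : simple_words gs c (reflection s *m T).
    apply: HM => //; exists [:: s]; last by rewrite /= mulmx1.
    by move=> r; rewrite inE => /eqP ->.
  have := Tmin _ ((memH _).2 HsT).
  rewrite lerN2 leNgt => /negP; apply.
  rewrite -mulmxA reflectionE dotDr dotNr dotZr ltrDl oppr_gt0.
  have [[_ sc] _] := ss; rewrite (dotC c) pmulr_llt0 //.
  by rewrite pmulr_llt0 ?invr_gt0 ?dot_gt0 // pmulr_rlt0.
apply/seteqP; split=> x sx; last by split; [case: sx|exact: nosep].
have [//|nx] := pm_star gen (proj1 sx).
have := nosep _ nx; rewrite dotNl oppr_gt0; case: sx => _ /lt_trans h /h.
by rewrite ltxx.
Qed.

(** A generic direction [p] on the hyperplane of [r] spans a chamber that has
    [r] as a wall.  A product of simple reflections moving that chamber to the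
    one of [c] moves [r] to a simple root. *)
Lemma reflection_simple_words r : spanning gs -> pm gs r ->
  simple_words gs c (reflection r).
Proof.
move=> sp pr; have r0 := pm_neq0 n0 pr.
have [p rp only] := wall_direction red pr.
have [e e0 he] := lex_direction (pm_seq gs) p r.
have sgE x : pm gs x -> Num.sg (dot x (p + e *: r)) =
    if dot x p == 0 then Num.sg (dot x r) else Num.sg (dot x p).
  by move=> px; apply: he; apply/mem_pm_seq.
have rr : Num.sg (dot r r) = 1 by rewrite gtr0_sg // dot_gt0.
have gen1 : generic gs (p + e *: r).
  move=> g /pm_gen pg; rewrite -sgr_eq0 sgE //; case: ifPn => gp; rewrite sgr_eq0 //.
  by case: (only g pg (eqP gp)) => ->; rewrite ?dotNl ?oppr_eq0 dot_eq0.
have [T HT TE] := chamber_transitive sp gen1.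
have [oT Tpm] := simple_words_pm HT.
have sT : star gs c = mximage T (star gs (p + e *: r)).
  by rewrite star_orthogonal.
have sr : star gs (p + e *: r) r.
  by split=> //; rewrite -sgr_cp0 sgE // rp eqxx rr.
have simTr : simple gs c (T *m r).
  apply: (@simple_wall _ _ _ (T *m p)) => //.
  - by rewrite sT; exists r.
  - by rewrite dot_orthogonal.
  move=> x; rewrite sT => -[y [py yc] <-] yr; rewrite dot_orthogonal //.
  move: yc; rewrite -!sgr_cp0 sgE //; case: ifPn => // yp.
  case: (only y py (eqP yp)) => yE; first by rewrite yE in yr.
  by rewrite yE dotNl sgrN rr eq_sym -subr_eq0 opprK (pnatr_eq0 R 2).
have -> : reflection r = invmx T *m reflection (T *m r) *m T.
  rewrite orthogonal_inv // reflection_conj // !mulmxA oT mul1mx.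
  by rewrite -mulmxA oT mulmx1.
have [_ _ HM HV] := simple_words_subgroup.
apply: (HM) => //; apply: (HM); first exact: HV.
exists [:: T *m r]; last by rewrite /= mulmx1.
by move=> s; rewrite inE => /eqP ->.
Qed.

(** The exchange condition: if the word [w] makes the simple root [s] negative,
    then some letter [t] of [w] is responsible, and the letters after [t] map
    [s] to [t]; multiplying by the reflection of [s] erases [t]. *)
Lemma word_exchange w s : (forall t, t \in w -> simple gs c t) ->
  simple gs c s -> star gs c (- (word w *m s)) ->
  exists w', [/\ (forall t, t \in w' -> simple gs c t), (size w' < size w)%N &
    word w *m reflection s = word w'].
Proof.
elim: w => [|t w IH] sw ss /=.
  rewrite mul1mx => -[_]; rewrite dotNl oppr_gt0; case: ss => -[_ /lt_trans h] _ /h.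
  by rewrite ltxx.
have sw' r : r \in w -> simple gs c r by move=> rw; apply: sw; rewrite inE rw orbT.
have st : simple gs c t by apply: sw; rewrite mem_head.
have [oW Wpm] : pm_group gs (word w) by apply: simple_words_pm; exists w.
have pb : pm gs (word w *m s) by rewrite -Wpm; exists s => //; exact: simple_pm.
have [pos|neg] := pm_star gen pb; last first.
  move=> _; have [w' [h1 h2 h3]] := IH sw' ss neg.
  exists (t :: w'); split=> //=; last by rewrite -mulmxA h3.
  by move=> r; rewrite inE => /orP[/eqP->|/h1].
rewrite -mulmxA => neg; exists w; split=> //.
have tE : word w *m s = t.
  apply: contrapT => ne; have [_ /(_ _ pos ne)[_]] := st.
  case: neg => _; rewrite dotNl oppr_gt0 => h /(lt_trans h).
  by rewrite ltxx.
have s0 := pm_neq0 n0 (simple_pm ss).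
rewrite -tE reflection_conj //.
have -> : word w *m reflection s *m (word w)^T *m word w = word w *m reflection s.
  by rewrite -!mulmxA oW mulmx1.
rewrite -mulmxA; have := reflection_orth s0.
by rewrite /orthogonal_group /= reflection_tr => ->; rewrite mulmx1.
Qed.

(** The last letter [s] of a nonempty word fixing the chamber is made negative by
    the letters before it, so the exchange condition shortens the word. *)
Lemma chamber_free T : simple_words gs c T ->
  mximage T (star gs c) = star gs c -> T = 1%:M.
Proof.
move=> [w sw ->]; have [n] := ubnP (size w).
elim: n w sw => // n IH; case/lastP => [|w s] sw; first by [].
rewrite size_rcons ltnS => wn TS.
have ss : simple gs c s by apply: sw; rewrite mem_rcons mem_head.
have sw' r : r \in w -> simple gs c r.
  by move=> rw; apply: sw; rewrite mem_rcons inE rw orbT.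
have neg : star gs c (- (word w *m s)).
  rewrite -TS -cats1 word_cat /= mulmx1; exists s; first by case: ss.
  by rewrite -mulmxA reflection_self mulmxN.
have [w' [h1 h2 h3]] := word_exchange sw' ss neg.
have eW : word (rcons w s) = word w' by rewrite -cats1 word_cat /= mulmx1.
rewrite eW in TS *; apply: IH => //; exact: ltn_trans h2 wn.
Qed.

End Chamber.

Definition reflection_group (A : set vec) : set mx :=
  smallest orthogonal_subgroup [set reflection r | r in A].

(** Since every reflection in a root is a product of simple reflections, for any
    choice of the chamber, the results on such products apply to the whole
    group, and vertices correspond to chambers. *)
Lemma root_system_permutahedron gs : reduced gs -> spanning gs ->
  polytope (zono gs) -> root_system (pm gs) ->
  exists G, finite_reflection_group G /\ permutahedron G (zono gs).
Proof.
move=> red sp poly [finR nR refl]; have [_ n0 _] := red.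
have rc : reflection_closed gs.
  by move=> r s pr ps; rewrite -(refl r pr); exists s.
pose G := reflection_group (pm gs).
have Gpm T : G T -> pm_group gs T.
  apply: smallest_sub; first exact: pm_group_subgroup.
  by move=> _ [r pr <-]; exact: reflection_pm_group.
have Gword c T : generic gs c -> G T -> simple_words gs c T.
  move=> gen; apply: smallest_sub; first exact: simple_words_subgroup.
  by move=> _ [r pr <-]; exact: reflection_simple_words.
have wordG c T : simple_words gs c T -> G T.
  move=> [w sw ->] K [oK sK]; apply: word_in => // s /sw /simple_pm ps.
  by apply: sK; exists s.
have Gvert T c : G T -> generic gs c ->
    generic gs (T *m c) /\ T *m vert gs c = vert gs (T *m c).
  move=> /Gpm[oT Tpm] gen; apply: generic_orthogonal => //.
  exact: pm_symmetry_zono.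
exists G; split.
  split; first exact: sub_finite_set Gpm (finite_pm_group sp).
  by exists (pm gs).
split=> //; split; first split.
- move=> T v GT /(vertices_zono _ n0)[c gen ->]; apply/vertices_zono => //.
  by have [gT ->] := Gvert T c GT gen; exists (T *m c).
- move=> v v' /(vertices_zono _ n0)[c gen ->] /(vertices_zono _ n0)[c' gen' ->].
  have [T HT TE] := chamber_transitive red rc gen' sp gen.
  have GT := wordG _ _ HT; exists T => //.
  have [gT ->] := Gvert T c GT gen.
  apply: eq_vert => g /[dup] ggs /pm_gen pg.
  have [h|h] := pm_star gen' pg.
    have := h; rewrite -TE => -[_ h1]; case: h => _ h2.
    by rewrite !gtr0_sg.
  have := h; rewrite -TE => -[_ h1]; case: h => _.
  by move: h1; rewrite !dotNl !oppr_gt0 => h1 h2; rewrite !ltr0_sg.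
- move=> T v GT /(vertices_zono _ n0)[c gen ->] Tv.
  have [gT vT] := Gvert T c GT gen; have [oT Tpm] := Gpm T GT.
  apply: (chamber_free red rc gen (Gword c T gen GT)).
  rewrite star_orthogonal //; apply: eq_star; apply: vert_sign => //.
  by rewrite -vT.
Qed.

(** * Permutahedra are vertex-transitive *)

(** A direction close to [c] and orthogonal to no generator gives a vertex that
    still maximizes [<., c>]. *)
Lemma supp_vertex gs c : 0 \notin gs ->
  exists2 v, vertices (zono gs) v & dot v c = supp gs c.
Proof.
move=> n0; have [//|//|g ggs|c' _ h] := @generic_direction R d setT gs c.
  by exists g => //; rewrite dot_eq0; apply: contraNneq n0 => <-.
exists (vert gs c'); first by apply/vertices_zono => //; exists c' => // g /h[].
rewrite /vert dot_suml; apply: eq_big_seq => g /h[_ e]; rewrite dotZl.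
have [->|gc] := eqVneq (dot g c) 0; first by rewrite mulr0 normr0.
by rewrite e // -normrEsg.
Qed.

(** The support function is the maximum over the vertices ([supp_vertex]), so it is
    preserved by a group permuting them, and by [zonoP] so is the zonotope. *)
Lemma permutahedron_vertex_transitive gs G : reduced gs ->
  finite_reflection_group G -> permutahedron G (zono gs) ->
  vertex_transitive (zono gs).
Proof.
move=> [_ n0 _] [_ [Rt [_ nRt GE]]] [_ [[Gv Gtrans] _]].
have Gorth T : G T -> orthogonal_group T.
  rewrite GE; apply: smallest_sub; first exact: orthogonal_subgroupT.
  by move=> _ [r Rr <-]; apply: reflection_orth; apply: contra_not_neq nRt => <-.
have GV T : G T -> G T^T.
  move=> GT; rewrite -orthogonal_inv; last exact: Gorth.
  move: GT; rewrite GE => GT K [oK sK]; have [_ _ _] := oK; apply.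
  exact: GT.
have vin v : vertices (zono gs) v -> zono gs v.
  by move=> /(vertices_zono _ n0)[c _ ->]; exact: zono_vert.
have Gz T x : G T -> zono gs x -> zono gs (T *m x).
  move=> GT /zonoP zx; apply/zonoP => c; rewrite dot_mulmx.
  have [v vv ve] := supp_vertex (T^T *m c) n0.
  apply: le_trans (zx _) _; rewrite -ve -dot_mulmx.
  by have /zonoP := vin _ (Gv T v GT vv); apply.
have GAut T : G T -> Aut (zono gs) T.
  move=> GT; have oT := Gorth _ GT; split=> //.
  apply/seteqP; split=> x; first by move=> [y zy <-]; exact: Gz.
  by move=> zx; exists (T^T *m x); [apply: Gz => //; exact: GV|rewrite orthogonalVK].
split; last by move=> v v' vv vv'; have [T /GAut] := Gtrans v v' vv vv'; exists T.
move=> T v [oT TZ] /(vertices_zono _ n0)[c gen ->]; apply/vertices_zono => //.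
by have [gT ->] := generic_orthogonal oT TZ n0 gen; exists (T *m c).
Qed.

End RootSystem.

(** * The equivalence *)

Theorem theorem4p12 (R : realType) (d : nat) (Z : set 'cV[R]_d) :
  (2 <= d)%N -> zonotope Z -> full_dimensional Z ->
  Z = [set - x | x in Z] ->
  [<-> vertex_transitive Z;
       forall S S' : set 'cV[R]_d,
         semi_star (Gen Z) S -> semi_star (Gen Z) S' -> congruent S S';
       root_system (Gen Z);
       exists G : set 'M[R]_d, finite_reflection_group G /\ permutahedron G Z].
Proof.
move=> _ zZ fullZ symZ; have [poly _] := zZ.
have [gs0 ZE0] := symmetric_zonotope zZ symZ.
have [gs red e] := exists_reduced gs0.
have ZE : Z = zono gs by rewrite ZE0; exact: eq_supp_zono.
rewrite {}ZE in poly fullZ *; rewrite Gen_zono //.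
have [_ n0 _] := red.
tfae.
- by move=> vt S S'; exact: vertex_transitive_congruent.
- move=> cong; split; first exact: finite_pm.
    by move=> /(pm_neq0 n0); rewrite eqxx.
  move=> r pr; have r0 := pm_neq0 n0 pr.
  apply/seteqP; split=> x; first by move=> [s ps <-]; exact: all_congruent_reflection.
  move=> px; exists (reflection r *m x); last exact: reflectionK.
  exact: all_congruent_reflection.
- exact: root_system_permutahedron (full_dimensional_spanning fullZ) poly.
- by move=> [G [fG pG]]; exact: permutahedron_vertex_transitive fG pG.
Qed.
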